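(* Let $A\in\mathbb{R}^{n\times n}$ with left eigenbases $X_1,\dots,X_p$ associated with its distinct eigenvalues $\lambda_1,\dots,\lambda_p$, and let $\bar B\in\{0,\ast\}^{n\times l}$ satisfy the independent-matching condition. Then Algorithm 1 (specified in the context) deterministically finds, in polynomial time, a real matrix $B\in\bar{\mathcal{B}}$ such that $(A,B)$ is controllable.
   Context: $(A,B)$ controllable refers to the system $\dot x(t)=Ax(t)+Bu(t)$. For a pattern $\bar B\in\{0,\ast\}^{n\times l}$, $\bar{\mathcal{B}}=\{P\in\mathbb{R}^{n\times l}:P_{ij}=0\text{ if }\bar B_{ij}=0\}$. For each $i$, $k_i=n-\mathrm{rank}(\lambda_iI-A)$ is the geometric multiplicity of $\lambda_i$, and $X_i\in\mathbb{C}^{n\times k_i}$ has linearly independent columns spanning the left null space of $\lambda_iI-A$ (so $X_i^{\intercal}(\lambda_iI-A)=0$). $X_{i\mathcal{J}}^{\intercal}$ denotes the columns of $X_i^{\intercal}$ indexed by $\mathcal{J}$, and for a matrix $M$, $M_{\phi}$ denotes the submatrix of columns indexed by $\phi$. Let $H_i=\{\mathcal{J}\subseteq\{1,\dots,n\}:|\mathcal{J}|=k_i,\ X_{i\mathcal{J}}^{\intercal}\text{ has full row rank}\}$. Independent-matching condition for $\bar B$: form the digraph with vertices $\mathcal{U}=\{u_1,\dots,u_l\}$ (inputs), $\mathcal{V}_s=\{1,\dots,n\}$ (states), and mode vertices $m_i=\{m_{i1},\dots,m_{ik_i}\}$, $i=1,\dots,p$, with edges $(u_i,j)$ when $\bar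 B_{ji}\ne0$ and $(i,m_{jk})$ when $(X_j^{\intercal})_{ki}\ne0$. The condition is that for each $i=1,\dots,p$ there exist $k_i$ vertex-disjoint paths of the form $u\to s\to m$ with $u\in\mathcal{U}$, $s\in\mathcal{V}_s$, $m\in m_i$, such that the set of state vertices on these paths belongs to $H_i$. Equivalently: for each $i$ there is a $k_i\times k_i$ submatrix of $\bar B$ whose generic rank (maximum rank over values of its free parameters) is $k_i$ and whose row index set belongs to $H_i$. Algorithm 1. Input: $A$, $X_1,\dots,X_p$, $\bar B$. Step 1: for each $i\in\{1,\dots,p\}$ find a $k_i\times k_i$ submatrix of $\bar B$ of generic rank $k_i$ with row index set in $H_i$; let $\phi_i$ be its column index set; choose $k_i$ free parameters in this submatrix no two of which lie in the same row or the same column, and let $e^{(i)}_1,\dots,e^{(i)}_{k_i}\in\mathbb{R}^{n\times l}$ be the corresponding unit basis matrices ($e^{(i)}_j$ has entry $1$ at the position of the $j$th chosen parameter and zeros elsewhere). (Step 1 can be carried out using the matroid intersection algorithm.) Step 2: set $B=0$ and $c^\ast=0$. Step 3: for $i=1,\dots,p$ do: if $\det(X_i^{\intercal}B_{\phi_i})=0$, then for each $m=1,\dots,1+\sum_{q=1}^pk_q$ set $B^{(m,i)}=B+\sum_{j=1}^{k_i}m\,e^{(i)}_j$ and $\mathcal{Z}_m=\{q\in\{1,\dots,p\}:\det(X_q^{\intercal}B^{(m,i)}_{\phi_q})\neq0\}$; choose $m^\ast\in\arg\max_m|\mathcal{Z}_m|$, set $c^\ast=|\mathcal{Z}_{m^\ast}|$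 and replace $B$ by $B+\sum_{j=1}^{k_i}m^\ast e^{(i)}_j$. If $c^\ast=p$, stop and return $B$. *)

(* Defs.v *)
From HB Require Import structures.
From mathcomp Require Import all_boot all_order all_algebra.
From mathcomp Require Import all_classical all_reals all_analysis.
From mathcomp Require Import complex.

Set Implicit Arguments.
Unset Strict Implicit.
Unset Printing Implicit Defensive.

Import Order.TTheory GRing.Theory Num.Theory.
Import numFieldNormedType.Exports.

Local Open Scope ring_scope.

(** State controllability of [x' = A x + B u]: any initial state can be steered
    to any final state in some finite time by a continuous input. *)
Definition controllable (R : realType) (n l : nat)
    (A : 'M[R]_n) (B : 'M[R]_(n, l)) : Prop :=
  forall x0 x1 : 'cV[R]_n,
  exists (T : R) (u : R -> 'cV[R]_l) (x : R -> 'cV[R]_n),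
    [/\ 0 < T,
        forall j, continuous (fun t : R => u t j 0),
        forall t, 0 <= t <= T -> forall i,
          is_derive t 1 (fun s : R => x s i 0) ((A *m x t + B *m u t) i 0),
        x 0 = x0
      & x T = x1].

(** In a pattern, [true] stands for a free entry and [false] for a zero. *)
Definition in_pattern (R : realType) (n l : nat)
    (Bbar : 'M[bool]_(n, l)) (P : 'M[R]_(n, l)) : Prop :=
  forall i j, ~~ Bbar i j -> P i j = 0.

Definition generic_rank (R : realType) (a b : nat)
    (M : 'M[bool]_(a, b)) (r : nat) : Prop :=
  (exists P : 'M[R]_(a, b), in_pattern M P /\ \rank P = r) /\
  (forall P : 'M[R]_(a, b), in_pattern M P -> (\rank P <= r)%N).

Definition cmx (R : realType) (m n : nat) (M : 'M[R]_(m, n)) : 'M[R[i]]_(m, n) :=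
  map_mx (real_complex R) M.

Definition geom_mult (R : realType) (n : nat) (A : 'M[R]_n) (a : R[i]) : nat :=
  (n - \rank (a%:M - cmx A)%R)%N.

Section EigenData.

Variables (R : realType) (n l p : nat).
Variables (A : 'M[R]_n) (lam : 'I_p -> R[i]).

Local Notation k i := (geom_mult A (lam i)).

(** [lam] enumerates the distinct eigenvalues of [A], and the columns of [X i]
    form a basis of the left null space of [lam i I - A].  [kermx M] is the
    left kernel of [M], as a row space. *)
Definition left_eigenbases (X : forall i, 'M[R[i]]_(n, k i)) : Prop :=
  [/\ injective lam,
      forall a, eigenvalue (cmx A) a <-> exists i, a = lam i
    & forall i, row_free (X i)^T
                /\ ((X i)^T == kermx ((lam i)%:M - cmx A))%MS].

Variable X : forall i, 'M[R[i]]_(n, k i).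

Definition Hset (i : 'I_p) : {set {set 'I_n}} :=
  [set J : {set 'I_n} | (#|J| == k i)
     && row_free (colsub (fun j : 'I_#|J| => enum_val j) (X i)^T)].

Variable Bbar : 'M[bool]_(n, l).

Definition vertex : Type := ('I_l + 'I_n + {q : 'I_p & 'I_(k q)})%type.

Definition input_vertex (u : 'I_l) : vertex := inl (inl u).
Definition state_vertex (s : 'I_n) : vertex := inl (inr s).
Definition mode_vertex (q : 'I_p) (r : 'I_(k q)) : vertex :=
  inr (Tagged (fun q => 'I_(k q)) r).

Definition edge (v w : vertex) : bool :=
  match v, w with
  | inl (inl u), inl (inr s) => Bbar s u
  | inl (inr s), inr m => (X (tag m))^T (tagged m) s != 0
  | _, _ => false
  end.

Definition independent_matching : Prop :=
  forall i : 'I_p,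
  exists (u : 'I_(k i) -> 'I_l) (s : 'I_(k i) -> 'I_n) (r : 'I_(k i) -> 'I_(k i)),
  let pth a := [:: input_vertex (u a); state_vertex (s a); mode_vertex (r a)] in
    [/\ forall a, sorted edge (pth a),
        forall a b, a != b -> [disjoint pth a & pth b]
      & [set s a | a : 'I_(k i)] \in Hset i].

(** The [k] x [k] submatrix is given by the increasing enumerations of its row
    and column index sets; [par j] is the position (in the whole matrix) of the
    [j]-th chosen parameter. *)
Record choice (k : nat) : Type := Choice {
  rows : 'I_k -> 'I_n;
  cols : 'I_k -> 'I_l;
  par : 'I_k -> 'I_n * 'I_l
}.

Definition valid_choice (i : 'I_p) (S : choice (k i)) : Prop :=
  [/\ {homo rows S : a b / (a < b)%N},
      {homo cols S : a b / (a < b)%N},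
      generic_rank R (mxsub (rows S) (cols S) Bbar) (k i),
      [set rows S a | a : 'I_(k i)] \in Hset i
    & [/\ forall j, [/\ (par S j).1 \in codom (rows S),
                        (par S j).2 \in codom (cols S)
                      & Bbar (par S j).1 (par S j).2],
          injective (fun j => (par S j).1)
        & injective (fun j => (par S j).2)]].

Definition choices : Type := forall i, choice (k i).

Definition step1_valid (S : choices) : Prop := forall i, valid_choice (S i).

Variable S : choices.

Definition mode_det (q : 'I_p) (B : 'M[R]_(n, l)) : R[i] :=
  \det ((X q)^T *m colsub (cols (S q)) (cmx B)).

Definition update (i : 'I_p) (B : 'M[R]_(n, l)) (m : nat) : 'M[R]_(n, l) :=
  B + \sum_(j < k i) m%:R *: delta_mx (par (S i) j).1 (par (S i) j).2.

Definition Zset (B : 'M[R]_(n, l)) : {set 'I_p} := [set q | mode_det q B != 0].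

Definition in_range (m : nat) : bool := (1 <= m <= 1 + \sum_q k q)%N.

(** [sel i B] is the value of [m*] picked in iteration [i] when the current
    matrix is [B]; such a rule resolves the ties in the arg max. *)
Definition argmax_rule (sel : 'I_p -> 'M[R]_(n, l) -> nat) : Prop :=
  forall i B, in_range (sel i B) /\
    forall m, in_range m ->
      (#|Zset (update i B m)| <= #|Zset (update i B (sel i B))|)%N.

(** [None] means that the loop ends without returning a matrix. *)
Fixpoint step3 (sel : 'I_p -> 'M[R]_(n, l) -> nat) (s : seq 'I_p)
    (B : 'M[R]_(n, l)) (cstar : nat) : option 'M[R]_(n, l) :=
  if s is i :: s' then
    let: (B', cstar') :=
      if mode_det i B == 0
      then let B1 := update i B (sel i B) in (B1, #|Zset B1|)
      else (B, cstar) in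
    if cstar' == p then Some B' else step3 sel s' B' cstar'
  else None.

Definition steps23 (sel : 'I_p -> 'M[R]_(n, l) -> nat) : option 'M[R]_(n, l) :=
  step3 sel (enum 'I_p) 0 0.

End EigenData.

(** The model of computation: a first-order functional language with unit-cost exact field arithmetic (as
    in the Blum-Shub-Smale model), equality tests on scalars, and bounded loops
    over lists and unary natural numbers.  Its only scalar constants are 0 and
    1, and a program is a single finite object used for all input sizes.  The
    running time is the number of evaluated constructors and loop turns; data
    are immutable and shared, so that every elementary operation creates at most
    one cell. *)

Inductive ty : Type :=
| Unit | Bool | Nat | Scal
| Prod of ty & ty
| List of ty.

Inductive prog : ty -> ty -> Type :=
| PId a : prog a a
| PComp a b c : prog b c -> prog a b -> prog a c
| PUnit a : prog a Unit
| PPair a b c : prog a b -> prog a c -> prog a (Prod b c)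
| PFst a b : prog (Prod a b) a
| PSnd a b : prog (Prod a b) b
| PTrue a : prog a Bool
| PFalse a : prog a Bool
| PIf a b : prog a Bool -> prog a b -> prog a b -> prog a b
| PZero a : prog a Nat
| PSucc : prog Nat Nat
| PNatCase a b : prog a b -> prog (Prod Nat a) b -> prog (Prod Nat a) b
| PNatIter a : prog a a -> prog (Prod Nat a) a
| PNil a b : prog a (List b)
| PCons a : prog (Prod a (List a)) (List a)
| PListCase a b c :
    prog c b -> prog (Prod (Prod a (List a)) c) b -> prog (Prod (List a) c) b
| PListFold a b : prog (Prod a b) b -> prog (Prod (List a) b) b
| PS0 a : prog a Scal
| PS1 a : prog a Scal
| PSAdd : prog (Prod Scal Scal) Scal
| PSOpp : prog Scal Scal
| PSMul : prog (Prod Scal Scal) Scal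
| PSInv : prog Scal Scal
| PSIsZero : prog Scal Bool.

Section Semantics.

Variable F : fieldType.

Fixpoint den (a : ty) : Type :=
  match a with
  | Unit => unit
  | Bool => bool
  | Nat => nat
  | Scal => F
  | Prod a b => (den a * den b)%type
  | List a => seq (den a)
  end.

(** [eval t x] is the pair of the result of [t] on [x] and of its cost. *)
Fixpoint eval (a b : ty) (t : prog a b) : den a -> den b * nat :=
  match t in prog a b return den a -> den b * nat with
  | PId _ => fun x => (x, 1%N)
  | PComp _ _ _ g f => fun x =>
      let r := eval f x in let r' := eval g r.1 in (r'.1, (r.2 + r'.2).+1)
  | PUnit _ => fun _ => (tt, 1%N)
  | PPair _ _ _ f g => fun x =>
      let r := eval f x in let r' := eval g x in ((r.1, r'.1), (r.2 + r'.2).+1)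
  | PFst _ _ => fun x => (x.1, 1%N)
  | PSnd _ _ => fun x => (x.2, 1%N)
  | PTrue _ => fun _ => (true, 1%N)
  | PFalse _ => fun _ => (false, 1%N)
  | PIf _ _ c f g => fun x =>
      let r := eval c x in
      let r' := if r.1 then eval f x else eval g x in (r'.1, (r.2 + r'.2).+1)
  | PZero _ => fun _ => (0%N, 1%N)
  | PSucc => fun m => (m.+1, 1%N)
  | PNatCase _ _ f g => fun x =>
      let r := if x.1 is m.+1 then eval g (m, x.2) else eval f x.2 in
      (r.1, r.2.+1)
  | PNatIter _ f => fun x =>
      iter x.1 (fun acc => let r := eval f acc.1 in (r.1, (acc.2 + r.2).+1))
        (x.2, 1%N)
  | PNil _ _ => fun _ => ([::], 1%N)
  | PCons _ => fun x => (x.1 :: x.2, 1%N)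
  | PListCase _ _ _ f g => fun x =>
      let r := if x.1 is y :: s then eval g ((y, s), x.2) else eval f x.2 in
      (r.1, r.2.+1)
  | PListFold _ _ f => fun x =>
      foldl (fun acc y =>
               let r := eval f (y, acc.1) in (r.1, (acc.2 + r.2).+1))
        (x.2, 1%N) x.1
  | PS0 _ => fun _ => (0, 1%N)
  | PS1 _ => fun _ => (1, 1%N)
  | PSAdd => fun x => (x.1 + x.2, 1%N)
  | PSOpp => fun x => (- x, 1%N)
  | PSMul => fun x => (x.1 * x.2, 1%N)
  | PSInv => fun x => (x^-1, 1%N)
  | PSIsZero => fun x => (x == 0, 1%N)
  end.

Definition result (a b : ty) (t : prog a b) (x : den a) : den b := (eval t x).1.
Definition cost (a b : ty) (t : prog a b) (x : den a) : nat := (eval t x).2.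

End Semantics.

Definition Mat (a : ty) : ty := List (List a).

Definition InputTy : ty := Prod (Mat Scal) (Prod (List (Mat Scal)) (Mat Bool)).

(** One item per mode, as built by [enc_choice] below: row indices, column
    indices, positions of the chosen parameters. *)
Definition ChoicesTy : ty :=
  List (Prod (Prod (List Nat) (List Nat)) (List (Prod Nat Nat))).

(** [prog1] computes the data of Step 1 and [prog23] then runs Steps 2 and 3. *)
Definition full_prog (prog1 : prog InputTy ChoicesTy)
    (prog23 : prog (Prod InputTy ChoicesTy) (Mat Scal)) : prog InputTy (Mat Scal) :=
  PComp prog23 (PPair (PId InputTy) prog1).

Definition enc_mx (T : Type) (m n : nat) (M : 'M[T]_(m, n)) : seq (seq T) :=
  [seq [seq M i j | j <- enum 'I_n] | i <- enum 'I_m].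

Section Encoding.

Variables (R : realType) (n l p : nat) (A : 'M[R]_n) (lam : 'I_p -> R[i]).

Local Notation k i := (geom_mult A (lam i)).

Definition enc_input (X : forall i, 'M[R[i]]_(n, k i)) (Bbar : 'M[bool]_(n, l)) :
    den R[i] InputTy :=
  (enc_mx (cmx A), ([seq enc_mx (X i) | i <- enum 'I_p], enc_mx Bbar)).

Definition enc_choice (k : nat) (S : choice n l k) :
    seq nat * seq nat * seq (nat * nat) :=
  ([seq val (rows S a) | a <- enum 'I_k],
   [seq val (cols S a) | a <- enum 'I_k],
   [seq (val (par S j).1, val (par S j).2) | j <- enum 'I_k]).

Definition enc_choices (S : choices l A lam) : den R[i] ChoicesTy :=
  [seq enc_choice (S i) | i <- enum 'I_p].

Definition enc_output (B : 'M[R]_(n, l)) : den R[i] (Mat Scal) :=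
  enc_mx (cmx B).

End Encoding.

(* Main.v *)
Require Import Defs.
From mathcomp Require Import all_boot all_order all_algebra.
From mathcomp Require Import all_classical all_reals all_analysis.
From mathcomp Require Import complex perm zify.

Set Implicit Arguments.
Unset Strict Implicit.
Unset Printing Implicit Defensive.

Import Order.TTheory GRing.Theory Num.Theory.
Local Open Scope ring_scope.

(** The algorithm works because singularity of a mode is a polynomial condition.
    When mode [i] is visited, the determinant of each mode [q] is a polynomial
    of degree at most [k q] in the multiplier [m] ([update_poly],
    [size_update_poly]).  It is not identically zero if mode [q] was already
    nonsingular, nor if [q = i]: the chosen parameters form a permutation matrix
    on a set of rows that belongs to [Hset], so the leading coefficient is
    nonzero ([par_mx_unit], [update_poly_neq0_diag]).  These polynomials have
    altogether at most [\sum_q k q] roots, so one of the [1 + \sum_q k q]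
    multipliers avoids them all ([good_multiplier]).  A multiplier with the
    largest number of nonsingular modes makes nonsingular every mode whose
    polynomial is not zero ([Zset_argmax]), hence every mode visited so far; at
    the end all the modes are nonsingular ([visit_all_Zset]).

    Then no left eigenvector of [A] is killed by [B], which is the
    Popov-Belevitch-Hautus criterion.  To obtain the steering control without
    the matrix exponential, one takes a vector [w] of polynomials and the
    trajectory [x = adj(D - A) B w], [u = char_poly A (D) w], where [D] is the
    derivation.  By the criterion the end points of [x] depend surjectively on
    the derivatives of [w] there ([pbh_span]), which are prescribed by Hermite
    interpolation ([pbh_controllable]).

    Finding the submatrices is a matroid intersection problem: one looks for
    free entries in distinct columns such that the rows of [X i] that they
    select are independent.  The program keeps a basis of the space, which
    initially consists of artificial vectors, and replaces its vectors one by
    one by rows of [X i].  Each replacement follows a shortest path of exchanges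
    from a free column to an artificial vector; it shortens the path or frees
    an artificial vector ([exchange]).  If there is no path while an artificial
    vector is left, then a determinant expansion and a pigeonhole argument
    contradict the existence of a matching ([no_hit_no_dummy]).  Independence
    is tested by division-free Gaussian elimination ([independentE]).

    The costs are obtained compositionally.  A program whose result is bounded
    by the same number as its argument ([good]) can be iterated, and remains of
    polynomial cost; almost all the programs below are of this kind, and the
    others ([tame]) only occur outside the loops that carry a state.  The
    results of the programs are computed by the rewriting rules [resultE], and
    are compared with the matrices that they encode ([result_basis_prog],
    [final_state], [result_step1_prog], [result_visit_prog],
    [result_steps23_prog]). *)

(** * Steering by polynomial trajectories *)

Lemma horner_derivn_expXsubC (K : fieldType) (c : K) (n : nat) :
  forall k (q : {poly K}), (k < n)%N -> (q * ('X - c%:P) ^+ n)^`(k).[c] = 0.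
Proof.
elim: n => // n IHn [|k] q ltkn.
  by rewrite derivn0 hornerM horner_exp hornerXsubC subrr expr0n mulr0.
have -> : (q * ('X - c%:P) ^+ n.+1)^`(k.+1) =
    ((q^`() * ('X - c%:P) + q *+ n.+1) * ('X - c%:P) ^+ n)^`(k).
  rewrite derivSn derivM deriv_exp derivXsubC mul1r /=; congr (_ ^`(k)).
  by rewrite exprS mulrA mulrDl mulrnAr mulrnAl.
exact: IHn.
Qed.

Lemma derivn_expXsubC (K : fieldType) (a c : K) (n : nat) :
  (a%:P * ('X - c%:P) ^+ n)^`(n) = (a * n`!%:R)%:P.
Proof.
elim: n a => [|n IHn] a; first by rewrite derivn0 expr0 !mulr1.
rewrite derivSn derivM derivC mul0r add0r deriv_exp derivXsubC mul1r /=.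
have -> : a%:P * (('X - c%:P) ^+ n *+ n.+1) = (a *+ n.+1)%:P * ('X - c%:P) ^+ n.
  by rewrite polyCMn mulrnAr mulrnAl.
by rewrite IHn factS natrM mulrA -[a *+ _]mulr_natr.
Qed.

(** Each power of ['X - c] corrects one more derivative without changing the
    lower ones. *)
Lemma taylor_interpolation (K : numFieldType) (c : K) (a : nat -> K) (n : nat) :
  exists p : {poly K}, forall k, (k < n)%N -> p^`(k).[c] = a k.
Proof.
elim: n => [|n [p IHp]]; first by exists 0.
pose d := (a n - p^`(n).[c]) / n`!%:R.
exists (p + d%:P * ('X - c%:P) ^+ n) => k.
rewrite ltnS leq_eqVlt => /predU1P[-> | ltkn].
  have nz : n`!%:R != 0 :> K by rewrite pnatr_eq0 -lt0n fact_gt0.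
  by rewrite derivnD hornerD derivn_expXsubC hornerC /d (divfK nz) addrC subrK.
by rewrite derivnD hornerD horner_derivn_expXsubC // addr0 IHp.
Qed.

(** By the Chinese remainder theorem: modulo [('X - c)^n] only the first [n]
    derivatives at [c] matter, and the two moduli are coprime. *)
Lemma hermite_interpolation (K : numFieldType) (c d : K) (a b : nat -> K) n :
  c != d -> exists p : {poly K}, forall k, (k < n)%N ->
    p^`(k).[c] = a k /\ p^`(k).[d] = b k.
Proof.
move=> neq_cd; have [p Hp] := taylor_interpolation c a n.
have [q Hq] := taylor_interpolation d b n.
pose P := ('X - c%:P) ^+ n; pose Q := ('X - d%:P) ^+ n.
have /Bezout_eq1_coprimepP[[u v] /= uv1] : coprimep P Q.
  by apply/coprimep_expl/coprimep_expr; rewrite coprimep_XsubC root_XsubC eq_sym.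
exists (p * (v * Q) + q * (u * P)) => k ltkn; split.
  have -> : p * (v * Q) + q * (u * P) = p + ((q - p) * u) * P.
    have -> : v * Q = 1 - u * P by rewrite -uv1 addrC addKr.
    by rewrite mulrBr mulr1 -addrA -mulrA mulrBl addrC [_ + q * _]addrC addrC.
  by rewrite derivnD hornerD horner_derivn_expXsubC // addr0 Hp.
have -> : p * (v * Q) + q * (u * P) = q + ((p - q) * v) * Q.
  have -> : u * P = 1 - v * Q by rewrite -uv1 addrK.
  by rewrite mulrBr mulr1 addrCA -mulrA mulrBl.
by rewrite derivnD hornerD horner_derivn_expXsubC // addr0 Hq.
Qed.

Section Controllability.

Variables (R : realType) (n l : nat) (A : 'M[R]_n) (B : 'M[R]_(n, l)).

(** The coefficient of ['X^k] in the adjugate of ['X I - A]. *)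
Definition adj_coef (k : nat) : 'M[R]_n :=
  \matrix_(i, j) ((\adj (char_poly_mx A)) i j)`_k.

(** These recurrences are the coefficients of
    [('X I - A) adj('X I - A) = char_poly A]. *)
Lemma adj_coef0 : - (A *m adj_coef 0) = ((char_poly A)`_0)%:M.
Proof.
apply/matrixP=> i j; have /matrixP/(_ i j) := mul_mx_adj (char_poly_mx A).
rewrite /char_poly_mx mulmxBl mul_scalar_mx !mxE => /(congr1 (coefp 0)) /=.
rewrite coefB coef_sum coefXM sub0r => H.
rewrite -coefMn -H; congr (- _).
by apply: eq_bigr => s _; rewrite !mxE coefCM.
Qed.

Lemma adj_coefS k : adj_coef k - A *m adj_coef k.+1 = ((char_poly A)`_k.+1)%:M.
Proof.
apply/matrixP=> i j; have /matrixP/(_ i j) := mul_mx_adj (char_poly_mx A).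
rewrite /char_poly_mx mulmxBl mul_scalar_mx !mxE => /(congr1 (coefp k.+1)) /=.
rewrite coefB coef_sum coefXM /= => H.
rewrite -coefMn -H; congr (_ - _).
by apply: eq_bigr => s _; rewrite !mxE coefCM.
Qed.

(** The entries of the adjugate are minors of size [n - 1]; here this follows
    from the recurrence, because the coefficients eventually vanish. *)
Lemma adj_coef_eq0 k : (n <= k)%N -> adj_coef k = 0.
Proof.
pose N := (\max_(i < n) \max_(j < n) size (\adj (char_poly_mx A) i j))%N.
have big0 k' : (N <= k')%N -> adj_coef k' = 0.
  move=> leNk; apply/matrixP=> i j; rewrite [LHS]mxE [RHS]mxE nth_default //.
  apply: leq_trans leNk.
  pose f i := (\max_(j < n) size (\adj (char_poly_mx A) i j))%N.
  apply: leq_trans (leq_bigmax (F := f) i).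
  exact: (leq_bigmax (F := fun j => size (\adj (char_poly_mx A) i j)) j).
move=> lenk; have [d] := ubnP (N - k)%N; elim: d k lenk => // d IHd k lenk ltd.
have [leNk | ltkN] := leqP N k; first exact: big0.
have C0 : adj_coef k.+1 = 0.
  apply: IHd; first exact: leqW.
  by rewrite -ltnS (leq_trans _ ltd) // ltnS subnS prednK // subn_gt0.
have := adj_coefS k; rewrite C0.
rewrite mulmx0 subr0 => ->; rewrite nth_default ?size_char_poly //.
by rewrite raddf0.
Qed.

Lemma adj_coef_lead : (0 < n)%N -> adj_coef n.-1 = 1%:M.
Proof.
move=> n_gt0; have := adj_coefS n.-1; rewrite prednK // (adj_coef_eq0 (leqnn n)) mulmx0.
rewrite subr0 => ->; have := char_poly_monic A.
by rewrite monicE lead_coefE size_char_poly /= => /eqP ->.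
Qed.

(** The Popov-Belevitch-Hautus condition, on left eigenvectors. *)
Definition pbh : Prop := forall (a : R[i]) (v : 'rV[R[i]]_n),
  v *m cmx A = a *: v -> v *m cmx B = 0 -> v = 0.

(** The row vectors killing all [adj_coef k *m B] form an [A]-stable space,
    which over the complex numbers would contain an eigenvector. *)
Lemma pbh_span : pbh -> forall x : 'cV[R]_n, exists w : nat -> 'cV[R]_l,
  x = \sum_(k < n) adj_coef k *m B *m w k.
Proof.
move=> pbhAB x.
pose M (k : 'I_n) := (adj_coef k *m B)^T.
pose S := (\sum_(k < n) genmx (M k))%MS.
suff fullS : row_full S.
  have /sub_sumsmxP[v Dv] : (x^T <= S)%MS by exact: submx_full.
  have /choice[w Dw] (k : 'I_n) : exists w, v k *m genmx (M k) = w *m M k.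
    by apply/submxP; apply: submx_trans (submxMl _ _) _; rewrite genmxE.
  exists (fun k => if insub k is Some i then (w i)^T else 0).
  rewrite -[x]trmxK Dv linear_sum; apply: eq_bigr => k _.
  by rewrite /= valK Dw trmx_mul trmxK.
have [n0 | n_gt0] := posnP n.
  by rewrite /row_full eqn_leq rank_leq_col; move: (\rank S) => r; rewrite n0.
have [W defW] : exists W, W = kermx S^T by exists (kermx S^T).
have killW m (v : 'M[R]_(m, n)) :
    (v <= W)%MS <-> forall k : 'I_n, v *m adj_coef k *m B = 0.
  rewrite defW; split=> [/sub_kermxP vS0 k | v0].
    have /submxP[D DM] : (M k <= S)%MS.
      by apply: submx_trans (sumsmx_sup k _ _) => //; rewrite genmxE.
    rewrite -mulmxA -[adj_coef k *m B]trmxK -/(M k) DM trmx_mul mulmxA vS0.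
    by rewrite mul0mx.
  have SP : (S <= kermx v^T)%MS.
    apply/sumsmx_subP=> k _; rewrite genmxE; apply/sub_kermxP.
    by rewrite /M -trmx_mul mulmxA v0 trmx0.
  apply/sub_kermxP; rewrite -[v *m _]trmxK trmx_mul trmxK.
  by move/sub_kermxP: SP => ->; rewrite trmx0.
have stabW : stablemx W A.
  have W0 := (killW _ W).1 (submx_refl _).
  have WB : W *m B = 0.
    have ltn1 : (n.-1 < n)%N by rewrite prednK.
    by have := W0 (Ordinal ltn1); rewrite /= adj_coef_lead // mulmx1.
  apply/killW => -[[|k] ltkn] /=.
    rewrite -!mulmxA (mulmxA A).
    have -> : A *m adj_coef 0 = - ((char_poly A)`_0)%:M by rewrite -adj_coef0 opprK.
    by rewrite mulNmx mul_scalar_mx mulmxN -scalemxAr WB scaler0 oppr0.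
  rewrite -!mulmxA (mulmxA A).
  have -> : A *m adj_coef k.+1 = adj_coef k - ((char_poly A)`_k.+1)%:M.
    by rewrite -adj_coefS opprB addrC subrK.
  rewrite mulmxBl mul_scalar_mx mulmxBr -scalemxAr WB scaler0 subr0 mulmxA.
  exact: (W0 (Ordinal (ltnW ltkn))).
suff W0 : W = 0.
  by move/eqP: W0; rewrite defW kermx_eq0 /row_free mxrank_tr.
apply/eqP; apply: contraT => Wn0.
pose V := row_base W.
have r_gt0 : (0 < \rank W)%N by rewrite lt0n mxrank_eq0.
have [f Df] : exists f, V *m A = f *m V.
  by apply/submxP; rewrite -stablemx_row_base in stabW.
have [a /eigenvalueP[v fv vn0]] := eigenvalue_closed (cmx f) r_gt0.
have : v *m cmx V = 0.
  apply: (pbhAB a).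
    by rewrite -mulmxA /cmx -map_mxM /= Df map_mxM mulmxA fv -scalemxAl.
  have := (killW _ V).1; rewrite /V eq_row_base => /(_ (submx_refl _)).
  have ltn1 : (n.-1 < n)%N by rewrite prednK.
  move=> /(_ (Ordinal ltn1)); rewrite /= adj_coef_lead // mulmx1 => VB.
  by rewrite -mulmxA /cmx -map_mxM /= VB map_mx0 mulmx0.
move/eqP; rewrite mulmx_free_eq0 ?(negPf vn0) //.
by rewrite /cmx /row_free mxrank_map -/(row_free V) row_base_free.
Qed.

(** With [w] a vector of polynomials and [D] the derivation, [adj(D - A) B w]
    and [char_poly A (D) w] form a trajectory of the system; its end points
    depend on the derivatives of [w] there, which can be prescribed. *)
Lemma pbh_controllable : pbh -> controllable A B.
Proof.
move=> pbhAB x0 x1.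
have [w0 Dx0] := pbh_span pbhAB x0; have [w1 Dx1] := pbh_span pbhAB x1.
have /choice[w Hw] (j : 'I_l) : exists p : {poly R}, forall k, (k < n)%N ->
    p^`(k).[0] = w0 k j 0 /\ p^`(k).[1] = w1 k j 0.
  by apply: hermite_interpolation; rewrite eq_sym oner_neq0.
pose W k : 'cV[{poly R}]_l := \col_j (w j)^`(k).
pose x : 'cV[{poly R}]_n := \sum_(k < n) map_mx polyC (adj_coef k *m B) *m W k.
pose u : 'cV[{poly R}]_l := \sum_(k < n.+1) ((char_poly A)`_k)%:P *: W k.
have dW k i : ((W k) i 0)^`() = W k.+1 i 0 by rewrite !mxE.
have dyn : map_mx deriv x = map_mx polyC A *m x + map_mx polyC B *m u.
  have -> : map_mx deriv x =
      \sum_(k < n) map_mx polyC (adj_coef k *m B) *m W k.+1.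
    apply/matrixP=> i j; rewrite !mxE !summxE raddf_sum; apply: eq_bigr => k _.
    rewrite !mxE raddf_sum; apply: eq_bigr => s _ /=.
    by rewrite !mxE derivM derivC mul0r add0r -derivnS.
  pose E k : 'M[{poly R}]_(n, l) := map_mx polyC (adj_coef k *m B).
  pose A' := map_mx polyC A; pose B' := map_mx polyC B.
  have E0 : ((char_poly A)`_0)%:P *: B' = - (A' *m E 0).
    rewrite /A' /B' /E -map_mxM -map_mxZ /= -map_mxN mulmxA -mulNmx.
    by rewrite adj_coef0 mul_scalar_mx.
  have ES k : ((char_poly A)`_k.+1)%:P *: B' = E k - A' *m E k.+1.
    rewrite /A' /B' /E -map_mxM -map_mxZ /= -map_mxB mulmxA -mulmxBl.
    by rewrite adj_coefS mul_scalar_mx.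
  have Ax : A' *m x = \sum_(k < n.+1) A' *m E k *m W k.
    rewrite big_ord_recr /= {2}/E adj_coef_eq0 // mul0mx map_mx0 mulmx0 mul0mx.
    by rewrite addr0 mulmx_sumr; apply: eq_bigr => k _; rewrite mulmxA.
  rewrite -/A' -/B' Ax /u mulmx_sumr !big_ord_recl /= -scalemxAr scalemxAl E0.
  rewrite mulNmx addrACA subrr add0r -big_split /=; apply: eq_bigr => k _.
  by rewrite -scalemxAr scalemxAl ES mulmxBl addrC subrK.
exists 1, (fun t => map_mx (horner^~ t) u), (fun t => map_mx (horner^~ t) x).
split.
- exact: ltr01.
- move=> j; have -> : (fun t => map_mx (horner^~ t) u j 0) = horner (u j 0).
    by apply/funext => t; rewrite mxE.
  exact: continuous_horner.
- move=> t _ i.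
  have -> : (fun s => map_mx (horner^~ s) x i 0) = horner (x i 0).
    by apply/funext => s; rewrite mxE.
  have -> : (A *m map_mx (horner^~ t) x + B *m map_mx (horner^~ t) u) i 0
      = ((x i 0)^`()).[t].
    have /matrixP/(_ i 0) := dyn; rewrite mxE => ->.
    rewrite !mxE hornerD !horner_sum.
    by congr (_ + _); apply: eq_bigr => j _; rewrite !mxE hornerM hornerC.
  exact: is_derive_poly.
- rewrite Dx0; apply/matrixP=> i j; rewrite {j}ord1 mxE !summxE horner_sum.
  apply: eq_bigr => k _; rewrite !mxE horner_sum; apply: eq_bigr => s _.
  by rewrite !mxE hornerM hornerC (Hw s k _).1 // mxE.
- rewrite Dx1; apply/matrixP=> i j; rewrite {j}ord1 mxE !summxE horner_sum.
  apply: eq_bigr => k _; rewrite !mxE horner_sum; apply: eq_bigr => s _.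
  by rewrite !mxE hornerM hornerC (Hw s k _).2 // mxE.
Qed.

End Controllability.

(** * Choosing the multipliers *)

Lemma row_free_kerP (F : fieldType) (m n : nat) (M : 'M[F]_(m, n)) :
  row_free M <-> forall v : 'rV_m, v *m M = 0 -> v = 0.
Proof.
split=> [freeM v | M0]; first by move/eqP; rewrite mulmx_free_eq0 // => /eqP.
rewrite -kermx_eq0; apply/eqP/row_matrixP=> i; rewrite row0; apply: M0.
by rewrite -row_mul mulmx_ker row0.
Qed.

Lemma row_free_colsubP (F : fieldType) (m n k : nat) (f : 'I_k -> 'I_n)
    (M : 'M[F]_(m, n)) :
  row_free (colsub f M) <->
    forall v : 'rV_m, (forall a, (v *m M) 0 (f a) = 0) -> v = 0.
Proof.
have E (v : 'rV_m) : v *m colsub f M = colsub f (v *m M).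
  by apply/matrixP=> i j; rewrite !mxE; apply: eq_bigr => s _; rewrite !mxE.
split=> [/row_free_kerP M0 v v0 | M0].
  by apply: M0; rewrite E; apply/rowP=> a; have := v0 a; rewrite !mxE.
apply/row_free_kerP=> v; rewrite E => /rowP v0; apply: M0 => a.
by have := v0 a; rewrite !mxE.
Qed.

Lemma size_det_linear_entries (F : idomainType) (k : nat) (M : 'M[{poly F}]_k) :
  (forall i j, (size (M i j) <= 2)%N) -> (size (\det M) <= k.+1)%N.
Proof.
move=> szM; rewrite /determinant (leq_trans (size_sum _ _ _)) //.
apply/bigmax_leqP => /= s _; rewrite mulr_sign.
have E : (size (\prod_i M i (s i))%R <= k.+1)%N.
  apply: leq_trans (size_prod_leq _ _) _.
  rewrite leq_subLR cardT size_enum_ord addnS ltnS addnn -muln2.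
  apply: (@leq_trans (\sum_(i < k) 2)); first exact: leq_sum.
  by rewrite sum_nat_const card_ord.
by case: ifP; rewrite ?size_polyN.
Qed.

Section Step3.

Variables (R : realType) (n l p : nat) (A : 'M[R]_n) (lam : 'I_p -> R[i]).
Local Notation k i := (geom_mult A (lam i)).
Variable X : forall i, 'M[R[i]]_(n, k i).
Hypothesis eigX : left_eigenbases X.

Lemma mem_Hset (i : 'I_p) (f : 'I_(k i) -> 'I_n) : injective f ->
  ([set f a | a : 'I_(k i)] \in Hset X i) = row_free (colsub f (X i)^T).
Proof.
move=> injf; rewrite inE.
have -> : #|[set f a | a : 'I_(k i)]| == k i by rewrite card_imset ?card_ord.
rewrite /=.
apply/idP/idP=> /row_free_colsubP H; apply/row_free_colsubP=> v v0; apply: H => a.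
  by have /imsetP[b _ ->] := enum_valP a.
have Ja : f a \in [set f a | a : 'I_(k i)] by apply: imset_f.
by rewrite -(enum_rankK_in Ja Ja).
Qed.

Lemma eigenvector_in_basis (a : R[i]) (v : 'rV_n) :
  v *m cmx A = a *: v -> v != 0 ->
  exists2 i, a = lam i & exists y, v = y *m (X i)^T.
Proof.
move=> vA vn0; case: eigX => _ eigA basisX.
have /eigA[i Da] : eigenvalue (cmx A) a by apply/eigenvalueP; exists v.
exists i => //; apply/submxP; have [_ /andP[_ kerX]] := basisX i.
apply: submx_trans kerX; apply/sub_kermxP.
by rewrite mulmxBr vA mul_mx_scalar Da subrr.
Qed.

(** Therefore no mode is nonsingular for [B = 0], which makes 0 the right initial
    value of the counter. *)
Lemma geom_mult_gt0 i : (0 < k i)%N.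
Proof.
case: eigX => _ eigA basisX.
have /eigenvalueP[v vA vn0] : eigenvalue (cmx A) (lam i) by apply/eigA; exists i.
rewrite lt0n; apply/negP=> /eqP k0; have [_ /andP[_ kerX]] := basisX i.
have : (v <= (X i)^T)%MS.
  apply: submx_trans kerX; apply/sub_kermxP.
  by rewrite mulmxBr vA mul_mx_scalar subrr.
case/submxP=> y Dv; case/eqP: vn0; rewrite Dv; move: (X i) y {Dv kerX}.
by rewrite k0 => Xi y; rewrite thinmx0 mul0mx.
Qed.

Lemma num_eigenvalues_le : (p <= n)%N.
Proof.
case: eigX => injlam eigA _.
have := @max_poly_roots _ (char_poly (cmx A)) [seq lam i | i <- enum 'I_p].
rewrite size_map size_enum_ord size_char_poly ltnS; apply.
- by rewrite -size_poly_eq0 size_char_poly.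
- apply/allP=> _ /mapP[i _ ->]; rewrite -eigenvalue_root_char.
  by apply/eigA; exists i.
- by rewrite map_inj_uniq ?enum_uniq.
Qed.

Lemma num_eigenvalues_gt0 : (0 < n)%N -> (0 < p)%N.
Proof.
move=> n_gt0; case: eigX => _ eigA _.
have [a /eigA[i _]] := eigenvalue_closed (cmx A) n_gt0.
exact: leq_ltn_trans (ltn_ord i).
Qed.

Variables (Bbar : 'M[bool]_(n, l)) (S : choices l A lam).
Hypothesis validS : step1_valid X Bbar S.

Lemma choice_cols_inj i : injective (cols (S i)).
Proof.
have [_ colsS _ _ _] := validS i => a b eqab.
case: (ltngtP a b) => [ltab | ltba | /val_inj //].
  by have := colsS _ _ ltab; rewrite eqab ltnn.
by have := colsS _ _ ltba; rewrite eqab ltnn.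
Qed.

Lemma choice_rows_inj i : injective (rows (S i)).
Proof.
have [rowsS _ _ _ _] := validS i => a b eqab.
case: (ltngtP a b) => [ltab | ltba | /val_inj //].
  by have := rowsS _ _ ltab; rewrite eqab ltnn.
by have := rowsS _ _ ltba; rewrite eqab ltnn.
Qed.

Definition par_mx i : 'M[R]_(n, l) :=
  \sum_(j < k i) delta_mx (par (S i) j).1 (par (S i) j).2.

Lemma updateE i B m : update S i B m = B + m%:R *: par_mx i.
Proof. by rewrite /update scaler_sumr. Qed.

(** The chosen parameters put exactly one entry in each column of the submatrix,
    so that the product selects the columns of [X^T] indexed by a set of
    [Hset]. *)
Lemma par_mx_unit i :
  (X i)^T *m colsub (cols (S i)) (cmx (par_mx i)) \in unitmx.
Proof.
have [_ _ _ HS [parS inj1 inj2]] := validS i.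
have /fin_all_exists[c Dc] j : exists c, (par (S i) j).2 = cols (S i) c.
  by have [_ /codomP[c ->] _] := parS j; exists c.
have injc : injective c by move=> a b eqab; apply: inj2; rewrite !Dc eqab.
have bijc := injF_bij injc; case: bijc => g cK gK.
have -> : (X i)^T *m colsub (cols (S i)) (cmx (par_mx i)) =
    colsub (fun b => (par (S i) (g b)).1) (X i)^T.
  apply/matrixP=> a b; rewrite !mxE (bigD1 (par (S i) (g b)).1) //=.
  rewrite !mxE summxE (bigD1 (g b)) //= !mxE Dc gK !eqxx /=.
  rewrite [X in 1 + X]big1 => [|j neq_j]; last first.
    rewrite mxE Dc (inj_eq (@choice_cols_inj i)) andbC.
    by case: eqP => // bj; rewrite bj cK eqxx in neq_j.
  rewrite addr0 rmorph1 mulr1 big1 ?addr0 // => s neq_s.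
  rewrite !mxE summxE big1 ?rmorph0 ?mulr0 // => j _.
  rewrite mxE Dc (inj_eq (@choice_cols_inj i)).
  case: eqP => //= Ds; case: eqP => //= bj.
  by rewrite Ds bj cK eqxx in neq_s.
rewrite -row_free_unit -mem_Hset; last first.
  by move=> a b /inj1 /(can_inj gK).
suff -> : [set (par (S i) (g a)).1 | a : 'I_(k i)]
    = [set rows (S i) a | a : 'I_(k i)] by [].
apply/eqP; rewrite eqEcard; apply/andP; split.
  apply/fintype.subsetP=> _ /imsetP[a _ ->]; have [/codomP[b ->] _ _] := parS (g a).
  exact: imset_f.
rewrite !card_imset // ?card_ord //; last exact: choice_rows_inj.
by move=> a b /inj1 /(can_inj gK).
Qed.

(** The determinant of mode [q] as a polynomial in the multiplier chosen at
    mode [i]. *)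
Definition update_poly q i (B : 'M[R]_(n, l)) : {poly R[i]} :=
  \det (map_mx polyC ((X q)^T *m colsub (cols (S q)) (cmx B))
        + 'X *: map_mx polyC ((X q)^T *m colsub (cols (S q)) (cmx (par_mx i)))).

Lemma mode_det_update q i B m :
  mode_det X S q (update S i B m) = (update_poly q i B).[m%:R].
Proof.
rewrite /update_poly -horner_evalE -det_map_mx; congr (\det _).
apply/matrixP=> a b; rewrite updateE !mxE /= ?horner_evalE !hornerE.
rewrite mulr_sumr -big_split /=; apply: eq_bigr => s _.
by rewrite !mxE rmorphD rmorphM rmorph_nat mulrDr mulrCA.
Qed.

Lemma size_update_poly q i B : (size (update_poly q i B) <= (k q).+1)%N.
Proof.
apply: size_det_linear_entries => a b; rewrite !mxE.
rewrite (leq_trans (size_polyD _ _)) // geq_max (leq_trans (size_polyC_leq1 _)) //.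
set c := \sum_j _; have [-> | nz] := eqVneq c%:P 0; first by rewrite mulr0 size_poly0.
by rewrite mulrC size_mulX // ltnS size_polyC_leq1.
Qed.

(** Up to the factor [det E], it is a characteristic polynomial. *)
Lemma update_poly_neq0_diag i B : update_poly i i B != 0.
Proof.
set E := (X i)^T *m colsub (cols (S i)) (cmx (par_mx i)).
have Eu : E \in unitmx := par_mx_unit i.
set C := (X i)^T *m colsub (cols (S i)) (cmx B).
suff -> : update_poly i i B = (\det E)%:P * char_poly (- (invmx E *m C)).
  rewrite mulf_neq0 ?polyC_eq0 -?unitfE //.
  by rewrite -size_poly_eq0 size_char_poly.
rewrite -det_map_mx /char_poly /char_poly_mx -det_mulmx /update_poly -/E -/C.
congr (\det _); rewrite map_mxN opprK mulmxDr -map_mxM mulKVmx // addrC.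
by rewrite mul_mx_scalar.
Qed.

Lemma update_poly_neq0 q i B : q \in Zset X S B -> update_poly q i B != 0.
Proof.
rewrite inE => nz; apply: contraNneq nz => P0.
have := mode_det_update q i B 0; rewrite P0 horner0 updateE scale0r addr0.
by move=> ->.
Qed.

Lemma Zset_update_sub i B m q :
  q \in Zset X S (update S i B m) -> update_poly q i B != 0.
Proof.
by rewrite inE mode_det_update; apply: contraNneq => ->; rewrite horner0.
Qed.

(** The polynomials that do not vanish identically have at most
    [\sum_q k q] roots altogether. *)
Lemma good_multiplier i B : exists2 m, in_range A lam m &
  forall q, update_poly q i B != 0 -> q \in Zset X S (update S i B m).
Proof.
pose N := (1 + \sum_q k q)%N.
pose P := \prod_(q | update_poly q i B != 0) update_poly q i B.
have Pn0 : P != 0 by rewrite prodf_seq_neq0; apply/allP=> q _; apply/implyP.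
pose rs : seq R[i] := [seq m%:R | m <- iota 1 N].
have szP : (size P <= N)%N.
  apply: leq_trans (size_prod_leq _ _) _; rewrite leq_subLR addnCA add1n ltnS.
  rewrite (big_mkcond _ (fun q => k q)) /= big_mkcond /= -sum1_card.
  rewrite [X in (_ <= X + _)%N]big_mkcond /= -big_split /=; apply: leq_sum => q _.
  by rewrite unfold_in; case: ifP => // _; rewrite add1n size_update_poly.
have uniq_rs : uniq rs.
  by rewrite map_inj_uniq ?iota_uniq // => a b /eqP; rewrite eqr_nat => /eqP.
have : ~~ all (root P) rs.
  apply/negP=> all_rs; have := max_poly_roots Pn0 all_rs uniq_rs.
  by rewrite size_map size_iota ltnNge szP.
case/allPn=> x /mapP[m m_range ->] nroot; rewrite mem_iota in m_range.
exists m; first exact: m_range.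
move=> q nz; rewrite inE mode_det_update; apply: contraNneq nroot => rootq.
by rewrite /root /P (bigD1 q) //= hornerM rootq mul0r.
Qed.

Variable sel : 'I_p -> 'M[R]_(n, l) -> nat.
Hypothesis argmax_sel : argmax_rule X S sel.

(** A multiplier maximising the number of nonsingular modes realises all the
    modes that some multiplier can make nonsingular. *)
Lemma Zset_argmax i B :
  Zset X S (update S i B (sel i B)) = [set q | update_poly q i B != 0].
Proof.
have [_ max_sel] := argmax_sel i B.
have [m m_range mP] := good_multiplier i B.
apply/eqP; rewrite eqEcard; apply/andP; split.
  by apply/fintype.subsetP=> q Zq; rewrite inE (Zset_update_sub Zq).
apply: leq_trans (max_sel m m_range); apply: subset_leq_card.
by apply/fintype.subsetP=> q; rewrite inE => /mP.
Qed.

Definition visit B i :=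
  if mode_det X S i B == 0 then update S i B (sel i B) else B.

Lemma visit_in i B : i \in Zset X S (visit B i).
Proof.
rewrite /visit; case: ifPn => Zi; last by rewrite inE.
by rewrite Zset_argmax inE update_poly_neq0_diag.
Qed.

Lemma visit_sub i B : Zset X S B \subset Zset X S (visit B i).
Proof.
rewrite /visit; case: ifP => [_ | _]; last exact: subxx.
rewrite Zset_argmax; apply/fintype.subsetP=> q Zq.
by rewrite inE update_poly_neq0.
Qed.

Lemma visit_full i B : #|Zset X S B| = p -> visit B i = B.
Proof.
move=> Zp; rewrite /visit; have : i \in Zset X S B.
  suff -> : Zset X S B = [set: 'I_p]%SET by rewrite inE.
  by apply/eqP; rewrite eqEcard finset.subsetT cardsT card_ord Zp leqnn.
by rewrite inE => /negPf ->.
Qed.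

Lemma foldl_visit_full s B : #|Zset X S B| = p -> foldl visit B s = B.
Proof. by move=> Zp; elim: s => //= i s IHs; rewrite visit_full. Qed.

(** Stopping early changes nothing, because a visit leaves [B] unchanged as soon
    as all modes are nonsingular; and the counter always is the number of
    nonsingular modes. *)
Lemma step3_visit s B : s != [::] ->
  (forall i, i \in Zset X S B \/ i \in s) ->
  step3 X S sel s B #|Zset X S B| = Some (foldl visit B s).
Proof.
elim: s B => // i s IHs B _ covered /=.
have -> : (if mode_det X S i B == 0
    then (update S i B (sel i B), #|Zset X S (update S i B (sel i B))|)
    else (B, #|Zset X S B|)) = (visit B i, #|Zset X S (visit B i)|).
  by rewrite /visit; case: ifP.
have covered' j : j \in Zset X S (visit B i) \/ j \in s.
  have [Zj | ] := covered j; first by left; apply: (fintype.subsetP (visit_sub i B)).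
  by rewrite inE => /predU1P[-> | ]; [left; apply: visit_in | right].
case: eqP => [full | notfull]; first by rewrite foldl_visit_full.
apply: IHs => //; apply/eqP=> s0; case: notfull.
rewrite -[RHS]card_ord; apply: eq_card => j; rewrite [RHS]inE.
by have [Zj | ] := covered' j; [rewrite Zj | rewrite s0].
Qed.

Lemma card_Zset0 : #|Zset X S 0| = 0%N.
Proof.
apply: eq_card0 => q; rewrite !inE; apply/negbTE/negPn; rewrite /mode_det.
have -> : (X q)^T *m colsub (cols (S q)) (cmx (0 : 'M[R]_(n, l))) = 0.
  apply/matrixP=> a b; rewrite !mxE big1 // => s _.
  by rewrite !mxE rmorph0 mulr0.
have := geom_mult_gt0 q; case: (k q) => // kq _; rewrite det0 //.
Qed.

Lemma steps23_visit : (0 < n)%N ->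
  steps23 X S sel = Some (foldl visit 0 (enum 'I_p)).
Proof.
move=> n_gt0; rewrite /steps23 -(step3_visit (B := 0)).
- by rewrite card_Zset0.
- by rewrite -size_eq0 size_enum_ord -lt0n num_eigenvalues_gt0.
- by move=> i; right; rewrite mem_enum.
Qed.

Lemma visit_all_Zset i : i \in Zset X S (foldl visit 0 (enum 'I_p)).
Proof.
have sub s B : Zset X S B \subset Zset X S (foldl visit B s).
  elim: s B => [|j s IHs] B /=; first exact: subxx.
  exact: fintype.subset_trans (visit_sub j B) (IHs _).
have : i \in enum 'I_p by exact: mem_enum.
elim: (enum 'I_p) (0 : 'M[R]_(n, l)) => [//|j s IHs] B /=.
rewrite inE => /predU1P[<- | /IHs //].
exact: (fintype.subsetP (sub _ _)) (visit_in _ _).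
Qed.

Lemma visit_pattern s : in_pattern Bbar (foldl visit 0 s).
Proof.
have: in_pattern Bbar (0 : 'M[R]_(n, l)) by move=> i j _; rewrite mxE.
elim: s (0 : 'M[R]_(n, l)) => [//|q s IHs] B patB /=; apply: IHs.
rewrite /visit; case: ifP => // _ i j nBij; rewrite updateE !mxE patB // add0r.
rewrite summxE big1 ?mulr0 // => a _; rewrite mxE.
have [_ _ _ _ [parS _ _]] := validS q; have [_ _ Ba] := parS a.
case: eqP => //= Di; case: eqP => //= Dj.
by rewrite Di Dj Ba in nBij.
Qed.

(** A left eigenvector of the eigenvalue number [i] is a combination of the
    columns of [X i], which a nonsingular mode keeps away from the left kernel
    of [B]. *)
Lemma visit_controllable : controllable A (foldl visit 0 (enum 'I_p)).
Proof.
set B := foldl visit 0 (enum 'I_p).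
apply: pbh_controllable => a v vA vB; apply/eqP; apply: contraT => vn0.
have [i Da [y Dv]] := eigenvector_in_basis vA vn0.
have := visit_all_Zset i; rewrite -/B inE /mode_det -unitfE -unitmxE.
rewrite -row_free_unit => /row_free_kerP freeXB.
have y0 : y = 0.
  apply: freeXB; rewrite mulmxA -Dv.
  apply/rowP=> b; move/rowP/(_ (cols (S i) b)): vB; rewrite !mxE => v0.
  by rewrite -[RHS]v0; apply: eq_bigr => s _; rewrite mxE.
by case/eqP: vn0; rewrite Dv y0 mul0mx.
Qed.

End Step3.

(** * Exchanging basis vectors *)

Section Exchange.

Variables (F : fieldType) (k n l : nat).
Variables (x : nat -> 'rV[F]_k) (bb : nat -> nat -> bool).
Hypothesis bb_range : forall s u, bb s u -> (s < n)%N /\ (u < l)%N.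

Implicit Types (G : 'M[F]_k) (U S : 'I_k -> nat) (R : {set 'I_k}).

Definition set_row G (a : 'I_k) (v : 'rV[F]_k) : 'M[F]_k :=
  \matrix_(i, j) (if i == a then v 0 j else G i j).

Lemma mul_set_row (c : 'rV_k) G a v :
  c *m set_row G a v = c *m G + c 0 a *: (v - row a G).
Proof.
apply/rowP=> j; rewrite !mxE (bigD1 a) //= [in RHS](bigD1 a) //= !mxE eqxx.
rewrite mulrBr addrAC [_ + (_ - _)]addrC subrK; congr (_ + _).
by apply: eq_bigr => i /negPf ne; rewrite mxE ne.
Qed.

(** By Cramer's rule. *)
Lemma set_row_unit G a v : G \in unitmx ->
  (set_row G a v \in unitmx) = ((v *m invmx G) 0 a != 0).
Proof.
move=> Gu; have /esym := mulmxKV Gu v; move: (v *m invmx G) => y Dv.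
have rowG : row a G = delta_mx 0 a *m G by rewrite rowE.
rewrite -row_free_unit; apply/idP/idP=> [/row_free_kerP H | nz].
  apply: contraTneq isT => y0.
  have /rowP/(_ a) : y - delta_mx 0 a = 0.
    apply: H; rewrite mul_set_row rowG Dv -mulmxBl scalemxAl -mulmxDl.
    by rewrite !mxE y0 !eqxx sub0r scaleN1r subrr mul0mx.
  by rewrite !mxE y0 !eqxx sub0r => /eqP; rewrite oppr_eq0 oner_eq0.
apply/row_free_kerP=> c; rewrite mul_set_row rowG Dv -mulmxBl scalemxAl -mulmxDl.
move/eqP; rewrite mulmx_free_eq0 ?row_free_unit // => /eqP H.
have /rowP/(_ a) := H; rewrite !mxE !eqxx mulrBr mulr1 addrC subrK => /eqP.
rewrite mulf_eq0 (negPf nz) orbF => /eqP c0.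
by move: H; rewrite c0 scale0r addr0.
Qed.

(** The change of basis subtracts a multiple of the coordinate vector of [v] at
    all the positions but [a]. *)
Lemma coord_set_row G a (v w : 'rV[F]_k) b : G \in unitmx -> set_row G a v \in unitmx ->
  (v *m invmx G) 0 b = 0 -> b != a ->
  (w *m invmx (set_row G a v)) 0 b = (w *m invmx G) 0 b.
Proof.
move=> Gu Gu' vb ne; have := mulmxKV Gu' w.
move: (w *m invmx (set_row G a v)) => z <-.
rewrite mul_set_row mulmxDl mulmxK // -scalemxAl mulmxBl rowE mulmxK //.
move: (v *m invmx G) vb => y yb.
by rewrite !mxE yb eqxx (negPf ne) subrr mulr0 addr0.
Qed.

(** A position [b] holds the vector [row b G] and the column [U b]; the label
    [l] marks the positions that hold an artificial vector. *)
Definition exch_inv G U S : Prop :=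
  [/\ G \in unitmx,
      forall b, U b != l -> bb (S b) (U b) /\ row b G = x (S b)
    & forall a b, U a = U b -> U a != l -> a = b].

Definition cand G (u s : nat) (a : 'I_k) : bool :=
  bb s u && (set_row G a (x s) \in unitmx).

Definition grow_layer G U (R : {set 'I_k}) : {set 'I_k} :=
  [set b | (U b == l) ||
    [exists s : 'I_n, [exists a, (a \in R) && cand G (U b) s a]]].

(** The positions from which fewer than [d] exchanges free an artificial
    one. *)
Definition layer G U (d : nat) : {set 'I_k} := iter d (grow_layer G U) finset.set0.

Definition hit G U d u s a : bool :=
  [&& [forall b, U b != u], a \in layer G U d & cand G u s a].

Definition has_hit G U d : bool :=
  [exists u : 'I_l, [exists s : 'I_n, [exists a, hit G U d u s a]]].

Lemma has_hitP G U d :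
  reflect (exists u s a, hit G U d u s a) (has_hit G U d).
Proof.
apply: (iffP existsP) => [[u /existsP[s /existsP[a H]]] | [u [s [a H]]]].
  by exists (val u), (val s), a.
have /and3P[_ _ /andP[/bb_range[lts ltu] _]] := H.
exists (Ordinal ltu); apply/existsP; exists (Ordinal lts).
by apply/existsP; exists a.
Qed.

Lemma grow_layerP G U (R : {set 'I_k}) b :
  reflect (U b = l \/ exists s a, a \in R /\ cand G (U b) s a)
    (b \in grow_layer G U R).
Proof.
rewrite inE; apply: (iffP orP) => [[/eqP | /existsP[s /existsP[a /andP[Ra C]]]]
   | [-> | [s [a [Ra C]]]]]; [by left | by right; exists (val s), a | by left | right].
have /andP[/bb_range[lts _] _] := C.
apply/existsP; exists (Ordinal lts); apply/existsP; exists a.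
by apply/andP.
Qed.

Lemma layer_fix G U : grow_layer G U (layer G U k) = layer G U k.
Proof.
have mono : {homo grow_layer G U : R R' / R \subset R'}.
  move=> R R' sRR'; apply/fintype.subsetP=> b /grow_layerP[Ub | [s [a [Ra C]]]].
    by apply/grow_layerP; left.
  apply/grow_layerP; right; exists s, a; split=> //.
  exact: (fintype.subsetP sRR').
by have := fixsetK mono; rewrite /fixset card_ord.
Qed.

Definition solution (s u : 'I_k -> nat) : Prop :=
  [/\ forall j, bb (s j) (u j), injective u
    & (\matrix_(j, c) x (s j) 0 c : 'M[F]_k) \in unitmx].

(** If no exchange is possible, a vector of the solution with a nonzero
    coordinate at a position of the last layer [R] has its column held by a
    position of [R] that is not artificial.  The solution provides such vectors
    for all the positions of [R] at once, which is too many if one of them is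
    artificial. *)
Lemma no_hit_no_dummy G U S s u : exch_inv G U S -> solution s u ->
  ~~ has_hit G U k -> forall b, U b != l.
Proof.
case=> Gu labels injU [bbsu inju unitX] nohit b0; apply: contraNneq nohit => Ub0.
apply: contraT => nohit.
set Y := (\matrix_(j, c) x (s j) 0 c : 'M[F]_k) *m invmx G.
have Yu : Y \in unitmx by rewrite unitmx_mul unitX unitmx_inv.
(* some term of the Leibniz formula for the determinant is nonzero *)
have [sg Ysg] : exists sg : 'S_k, forall j, Y j (sg j) != 0.
  have : \det Y != 0 by rewrite -unitfE -unitmxE.
  apply: contraNP => none; apply/eqP; apply: big1 => sg _.
  have /existsP[j /eqP Yj] : [exists j, Y j (sg j) == 0].
    by apply: contraT => /existsPn H; case: none; exists sg.
  by rewrite (bigD1 j) //= Yj mul0r mulr0.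
have Yrow j : row j Y = x (s j) *m invmx G.
  by rewrite row_mul; congr (_ *m _); apply/rowP=> c; rewrite !mxE.
pose R := layer G U k.
have candY a : cand G (u ((sg^-1)%g a)) (s ((sg^-1)%g a)) a.
  rewrite /cand bbsu set_row_unit // -Yrow mxE.
  by have := Ysg ((sg^-1)%g a); rewrite permKV.
(* the injection of [R] into its positions that are not artificial *)
have /fin_all_exists[g Hg] (a : 'I_k) : exists b, a \in R ->
    U b = u ((sg^-1)%g a) /\ b \in R.
  case Ra : (a \in R); last by exists a.
  have [b /eqP Ub] : exists b, U b == u ((sg^-1)%g a).
    apply/existsP; apply: contraNT nohit => /existsPn nfree.
    apply/has_hitP; exists (u ((sg^-1)%g a)), (s ((sg^-1)%g a)), a.
    rewrite /hit Ra candY !andbT; apply/forallP=> b.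
    by apply/eqP=> Ub; have := nfree b; rewrite Ub eqxx.
  exists b => _; split=> //; rewrite /R -layer_fix; apply/grow_layerP; right.
  by exists (s ((sg^-1)%g a)), a; rewrite Ub.
have R0 : b0 \in R by rewrite /R -layer_fix; apply/grow_layerP; left.
have sub : [set g a | a in R] \subset R :\ b0.
  apply/fintype.subsetP=> _ /imsetP[a Ra ->]; have [Ug Rg] := Hg a Ra.
  rewrite !inE Rg andbT; apply: contraTneq isT => Db.
  have [_] := bb_range (bbsu ((sg^-1)%g a)).
  by rewrite -Ug Db Ub0 ltnn.
have := subset_leq_card sub; rewrite card_in_imset; last first.
  move=> a b Ra Rb Dg; have [Ua _] := Hg a Ra; have [Ub _] := Hg b Rb.
  by move: Ua; rewrite Dg Ub => /inju /perm_inj.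
by rewrite [X in (X <= _)%N](cardsD1 b0) R0 ltnn.
Qed.

Definition upd (f : 'I_k -> nat) (a : 'I_k) (v : nat) : 'I_k -> nat :=
  fun b => if b == a then v else f b.

Definition dummies U : nat := #|[set b | U b == l]|.

Definition first_hit G U : nat := find (has_hit G U) (iota 0 k.+1).

Lemma before_first_hit G U d : (d < first_hit G U)%N -> ~~ has_hit G U d.
Proof.
move=> ltd; have := before_find 0%N ltd.
have le := leq_trans ltd (find_size _ _); rewrite size_iota in le.
by rewrite nth_iota // => ->.
Qed.

Lemma first_hit_le G U d : (d <= k)%N -> has_hit G U d -> (first_hit G U <= d)%N.
Proof.
move=> led Hd; rewrite leqNgt; apply/negP=> /(before_find 0%N).
by rewrite nth_iota ?ltnS // add0n Hd.
Qed.

Lemma first_hit_eq G U d : (d <= k)%N -> has_hit G U d ->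
  (forall e, (e < d)%N -> ~~ has_hit G U e) -> first_hit G U = d.
Proof.
move=> led Hd before; apply/eqP; rewrite eqn_leq first_hit_le //= leqNgt.
apply/negP=> lt; have /negP := before _ lt; apply.
have H : has (has_hit G U) (iota 0 k.+1).
  by apply/hasP; exists d; rewrite // mem_iota add0n ltnS.
have := nth_find 0%N H; rewrite nth_iota //.
by have := H; rewrite has_find size_iota.
Qed.

Lemma first_hit_max G U : (first_hit G U <= k.+1)%N.
Proof. by rewrite -[X in (_ <= X)%N](size_iota 0 k.+1) find_size. Qed.

(** The weight of an artificial position exceeds the largest value of
    [first_hit], which is [k.+1] if there is no exchange. *)
Definition exch_measure G U : nat := (dummies U * k.+2 + first_hit G U)%N.

(** The new vector has zero coordinates at the positions of the earlier layers,
    which therefore only grow; so the column that the exchange frees has an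
    exchange at an earlier layer. *)
Lemma exchange G U S u s a : exch_inv G U S ->
    hit G U (first_hit G U) u s a ->
  let G' := set_row G a (x s) in let U' := upd U a u in let S' := upd S a s in
  exch_inv G' U' S' /\ (exch_measure G' U' < exch_measure G U)%N.
Proof.
move=> inv H G' U' S'; have [Gu labels injU] := inv.
have /and3P[/forallP freeu La /andP[bbsu Gu']] := H.
have [lts ltu] := bb_range bbsu.
have inv' : exch_inv G' U' S'.
  split=> // [b | b c].
    rewrite /U' /S' /upd; case: (b =P a) => [-> _ | /eqP ne Ub].
      by split=> //; apply/rowP=> j; rewrite !mxE eqxx.
    have [bbb rowb] := labels b Ub; split=> //; rewrite -rowb.
    by apply/rowP=> j; rewrite !mxE (negPf ne).
  rewrite /U' /upd; case: (b =P a) => [-> | _]; case: (c =P a) => [-> // | _].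
  - by move=> Du; have := freeu c; rewrite Du eqxx.
  - by move=> Du; have := freeu b; rewrite Du eqxx.
  exact: injU.
split=> //; rewrite /exch_measure.
have nohit := @before_first_hit G U.
have [Ua | Ua] := eqVneq (U a) l.
  have lt : (dummies U' < dummies U)%N.
    rewrite /dummies [X in (_ < X)%N](cardsD1 a) inE Ua eqxx add1n ltnS.
    apply: subset_leq_card; apply/fintype.subsetP=> b; rewrite !inE /U' /upd.
    by case: (b == a) => //= /eqP Dl; move: ltu; rewrite Dl ltnn.
  apply: (@leq_trans (dummies U * k.+2)); last exact: leq_addr.
  apply: leq_trans (leq_mul lt (leqnn _)); rewrite mulSn addnC ltn_add2r.
  by rewrite ltnS first_hit_max.
have -> : dummies U' = dummies U.
  apply: eq_card => b; rewrite !inE /U' /upd; case: (eqVneq b a) => // ->.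
  by rewrite (negPf Ua); apply/negbTE; rewrite neq_ltn ltu.
rewrite ltn_add2l; case Dd : (first_hit G U) La nohit => [|d] La nohit.
  by rewrite inE in La.
have led : (d < k.+1)%N by rewrite -ltnS -Dd ltnS first_hit_max.
have nhd := nohit d (ltnSn d).
have y0 b : b \in layer G U d -> (x s *m invmx G) 0 b = 0.
  move=> Lb; apply/eqP; apply: contraNT nhd => yb; apply/has_hitP.
  exists u, s, b; rewrite /hit Lb /cand bbsu set_row_unit // yb !andbT.
  exact/forallP.
have nLa : a \notin layer G U d.
  by apply/negP=> /y0/eqP; apply/negP; rewrite -set_row_unit.
have ccand v t b : b \in layer G U d -> cand G v t b -> cand G' v t b.
  move=> Lb /andP[bbv].
  rewrite /cand bbv (set_row_unit _ _ Gu) (set_row_unit _ _ Gu') coord_set_row //.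
    exact: y0.
  by apply: contraNneq nLa => <-.
have mono e : (e <= d)%N -> layer G U e \subset layer G U d.
  move=> /subnKC <-; elim: (d - e)%N => [|i IHi]; first by rewrite addn0.
  apply: fintype.subset_trans IHi _; rewrite addnS; elim: (e + i)%N => [|j IHj].
    by rewrite finset.sub0set.
  apply/fintype.subsetP=> b /grow_layerP[Ub | [t [c [Lc C]]]].
    by apply/grow_layerP; left.
  by apply/grow_layerP; right; exists t, c; split=> //; apply: (fintype.subsetP IHj).
have grow e : (e <= d)%N -> layer G U e \subset layer G' U' e.
  elim: e => [|e IHe] lee; first by rewrite finset.sub0set.
  apply/fintype.subsetP=> b Lb.
  have neb : b != a.
    by apply: contraNneq nLa => <-; apply: (fintype.subsetP (mono _ lee)).
  have Ub : U' b = U b by rewrite /U' /upd (negPf neb).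
  have /grow_layerP[Ubl | [t [c [Lc C]]]] := Lb; apply/grow_layerP; rewrite Ub.
    by left.
  right; exists t, c; split; first exact: (fintype.subsetP (IHe (ltnW lee))).
  by apply: ccand => //; apply: (fintype.subsetP (mono _ (ltnW lee))).
rewrite ltnS; apply: first_hit_le => //.
have /grow_layerP[// | [t [c [Lc C]]]] := La; first by move/eqP; rewrite (negPf Ua).
apply/has_hitP; exists (U a), t, c.
rewrite /hit (fintype.subsetP (grow d (leqnn d))) // ccand // !andbT.
apply/forallP=> b; rewrite /U' /upd; case: (b =P a) => [_ | ne].
  by rewrite eq_sym freeu.
by apply/eqP=> Ub; apply: ne; apply: injU; rewrite // Ub.
Qed.

Lemma dummies_exchange G U d u s a : hit G U d u s a ->
  (dummies (upd U a u) <= dummies U)%N.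
Proof.
case/and3P=> _ _ /andP[/bb_range[_ ltu] _]; apply: subset_leq_card.
apply/fintype.subsetP=> b; rewrite !inE /upd; case: (b == a) => // /eqP Dl.
by rewrite Dl ltnn in ltu.
Qed.

Lemma dummies_eq0 U : dummies U = 0%N -> forall b, U b != l.
Proof.
move=> /eqP; rewrite cards_eq0 => /eqP/setP D0 b.
by have := D0 b; rewrite !inE => ->.
Qed.

End Exchange.

(** * Programs of polynomial cost *)

Definition poly_bound (f : nat -> nat) : Prop :=
  exists c d, forall M, (f M <= c * M.+1 ^ d)%N.

Lemma poly_bound_le (f g : nat -> nat) :
  (forall M, f M <= g M)%N -> poly_bound g -> poly_bound f.
Proof. by move=> lefg [c [d H]]; exists c, d => M; apply: leq_trans (H M). Qed.

Lemma poly_bound_const c : poly_bound (fun=> c).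
Proof. by exists c, 0%N => M; rewrite expn0 muln1. Qed.

Lemma poly_bound_id : poly_bound id.
Proof. by exists 1%N, 1%N => M; rewrite mul1n expn1. Qed.

Lemma poly_bound_add f g :
  poly_bound f -> poly_bound g -> poly_bound (fun M => (f M + g M)%N).
Proof.
move=> [c [d Hf]] [c' [d' Hg]]; exists (c + c')%N, (d + d')%N => M.
rewrite mulnDl leq_add //.
  apply: leq_trans (Hf M) _; rewrite leq_mul2l; apply/orP; right.
  by rewrite leq_pexp2l // leq_addr.
apply: leq_trans (Hg M) _; rewrite leq_mul2l; apply/orP; right.
by rewrite leq_pexp2l // leq_addl.
Qed.

Lemma poly_bound_mul f g :
  poly_bound f -> poly_bound g -> poly_bound (fun M => (f M * g M)%N).
Proof.
move=> [c [d Hf]] [c' [d' Hg]]; exists (c * c')%N, (d + d')%N => M.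
by rewrite expnD mulnACA leq_mul.
Qed.

Lemma poly_bound_comp f g :
  poly_bound f -> poly_bound g -> poly_bound (fun M => f (g M)).
Proof.
move=> [c [d Hf]] [c' [d' Hg]]; exists (c * c'.+1 ^ d)%N, (d' * d)%N => M.
apply: leq_trans (Hf _) _; rewrite -mulnA leq_mul2l; apply/orP; right.
rewrite expnM -expnMn.
have le : ((g M).+1 <= c'.+1 * M.+1 ^ d')%N.
  by rewrite mulSn -add1n leq_add // expn_gt0.
by case: (d) => // d1; rewrite leq_exp2r.
Qed.

Lemma poly_bound_add2 c f g :
  poly_bound f -> poly_bound g -> poly_bound (fun M => (f M + g M + c)%N).
Proof.
by move=> Hf Hg; apply: poly_bound_add (poly_bound_const c); apply: poly_bound_add.
Qed.

Section Complexity.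

Variable F : fieldType.

(** All the lists, at any depth, and all the natural numbers of a datum are at
    most [M]. *)
Fixpoint bnd (a : ty) (M : nat) : den F a -> bool :=
  match a return den F a -> bool with
  | Unit | Bool | Scal => fun _ => true
  | Nat => fun m => (m <= M)%N
  | Prod a b => fun x => bnd M x.1 && bnd M x.2
  | List a => fun s => (size s <= M)%N && all (bnd M) s
  end.

Lemma bnd_le a M N (x : den F a) : (M <= N)%N -> bnd M x -> bnd N x.
Proof.
move=> leMN; elim: a x => //= [m lem | a IHa b IHb [x y] /= | a IHa s].
- exact: leq_trans leMN.
- by case/andP=> /IHa -> /IHb ->.
by case/andP=> szs alls; rewrite (leq_trans szs) //= (sub_all IHa).
Qed.

Definition poly_cost a b (t : prog a b) : Prop :=
  exists2 f, poly_bound f & forall M (x : den F a), bnd M x -> (cost t x <= f M)%N.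

Definition nonexpanding a b (t : prog a b) : Prop :=
  forall M (x : den F a), bnd M x -> bnd M (result t x).

Definition poly_size a b (t : prog a b) : Prop :=
  exists2 f, poly_bound f & forall M (x : den F a), bnd M x -> bnd (f M) (result t x).

(** A program whose result is no larger than its argument keeps its polynomial
    cost when it is iterated. *)
Definition good a b (t : prog a b) : Prop := poly_cost t /\ nonexpanding t.

(** Unlike [good], not preserved by iteration, but enough for composition and
    for the loops whose turns do not depend on each other. *)
Definition tame a b (t : prog a b) : Prop := poly_cost t /\ poly_size t.

Lemma good_tame a b (t : prog a b) : good t -> tame t.
Proof. by case=> ct nt; split=> //; exists id => //; apply: poly_bound_id. Qed.

Lemma poly_cost1 a b (t : prog a b) : (forall x : den F a, cost t x = 1%N) ->
  poly_cost t.
Proof. by move=> E; exists (fun=> 1%N); [apply: poly_bound_const | move=> M x _; rewrite E]. Qed.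

Lemma poly_cost_comp a b c (g : prog b c) (f : prog a b) :
  poly_cost g -> tame f -> poly_cost (PComp g f).
Proof.
move=> [cg Pg Hg] [[cf Pf Hf] [sf Ps Hs]].
exists (fun M => (cf M + cg (sf M) + 1)%N).
  by apply: poly_bound_add2 => //; apply: poly_bound_comp Ps.
by move=> M x Mx; rewrite /cost /= addn1 ltnS leq_add ?Hf ?Hg ?Hs.
Qed.

Lemma good_comp a b c (g : prog b c) (f : prog a b) :
  good g -> good f -> good (PComp g f).
Proof.
move=> [cg ng] gf; split; first exact: poly_cost_comp (good_tame gf).
by move=> M x Mx; apply: ng; apply: gf.2.
Qed.

Lemma tame_comp a b c (g : prog b c) (f : prog a b) :
  tame g -> tame f -> tame (PComp g f).
Proof.
move=> [cg [sg Pg Hg]] tf; split; first exact: poly_cost_comp.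
have [_ [sf Ps Hs]] := tf; exists (fun M => sg (sf M)).
  exact: poly_bound_comp.
by move=> M x Mx; apply: Hg; apply: Hs.
Qed.

Lemma poly_cost_pair a b c (f : prog a b) (g : prog a c) :
  poly_cost f -> poly_cost g -> poly_cost (PPair f g).
Proof.
move=> [cf Pf Hf] [cg Pg Hg]; exists (fun M => (cf M + cg M + 1)%N).
  exact: poly_bound_add2.
by move=> M x Mx; rewrite /cost /= addn1 ltnS leq_add ?Hf ?Hg.
Qed.

Lemma good_pair a b c (f : prog a b) (g : prog a c) :
  good f -> good g -> good (PPair f g).
Proof.
move=> [cf nf] [cg ng]; split; first exact: poly_cost_pair.
by move=> M x Mx; rewrite /result /= [bnd M _]nf //; apply: ng.
Qed.

Lemma tame_pair a b c (f : prog a b) (g : prog a c) :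
  tame f -> tame g -> tame (PPair f g).
Proof.
move=> [cf [sf Pf Hf]] [cg [sg Pg Hg]]; split; first exact: poly_cost_pair.
exists (fun M => sf M + sg M)%N; first exact: poly_bound_add.
move=> M x Mx; apply/andP; split.
  by apply: bnd_le (Hf M x Mx); apply: leq_addr.
by apply: bnd_le (Hg M x Mx); apply: leq_addl.
Qed.

Lemma poly_cost_if a b c (f g : prog a b) :
  poly_cost c -> poly_cost f -> poly_cost g -> poly_cost (PIf c f g).
Proof.
move=> [cc Pc Hc] [cf Pf Hf] [cg Pg Hg].
exists (fun M => (cc M + (cf M + cg M) + 1)%N).
  by apply: poly_bound_add2 => //; apply: poly_bound_add.
move=> M x Mx; rewrite /cost /= addn1 ltnS leq_add ?Hc //.
case: (Defs.eval c x).1.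
  by apply: leq_trans (leq_addr _ _); apply: Hf.
by apply: leq_trans (leq_addl _ _); apply: Hg.
Qed.

Lemma result_if a b c (f g : prog a b) (x : den F a) :
  result (PIf c f g) x = if result c x then result f x else result g x.
Proof. by rewrite /result /=; case: ifP. Qed.

Lemma good_if a b c (f g : prog a b) : good c -> good f -> good g ->
  good (PIf c f g).
Proof.
move=> [cc _] [cf nf] [cg ng]; split; first exact: poly_cost_if.
by move=> M x Mx; rewrite result_if; case: ifP => _; [apply: nf | apply: ng].
Qed.

Lemma good_base a b (t : prog a b) :
  (forall x : den F a, cost t x = 1%N) -> nonexpanding t -> good t.
Proof. by move=> ct nt; split=> //; apply: poly_cost1. Qed.

Lemma good_id a : good (PId a). Proof. exact: good_base. Qed.
Lemma good_unit a : good (PUnit a). Proof. exact: good_base. Qed.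
Lemma good_fst a b : good (PFst a b).
Proof. by apply: good_base => // M x /andP[]. Qed.
Lemma good_snd a b : good (PSnd a b).
Proof. by apply: good_base => // M x /andP[]. Qed.
Lemma good_true a : good (PTrue a). Proof. exact: good_base. Qed.
Lemma good_false a : good (PFalse a). Proof. exact: good_base. Qed.
Lemma good_zero a : good (PZero a). Proof. exact: good_base. Qed.
Lemma good_nil a b : good (PNil a b). Proof. exact: good_base. Qed.
Lemma good_s0 a : good (PS0 a). Proof. exact: good_base. Qed.
Lemma good_s1 a : good (PS1 a). Proof. exact: good_base. Qed.
Lemma good_sadd : good PSAdd. Proof. exact: good_base. Qed.
Lemma good_sopp : good PSOpp. Proof. exact: good_base. Qed.
Lemma good_smul : good PSMul. Proof. exact: good_base. Qed.
Lemma good_siszero : good PSIsZero. Proof. exact: good_base. Qed.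

Lemma tame_succ : tame PSucc.
Proof.
split; first exact: poly_cost1.
exists (fun M => (M + 1)%N) => [|M x /= Mx]; last by rewrite /result /= addn1.
exact: poly_bound_add poly_bound_id (poly_bound_const 1).
Qed.

Lemma good_natcase a b (f : prog a b) g : good f -> good g -> good (PNatCase f g).
Proof.
move=> [[cf Pf Hf] nf] [[cg Pg Hg] ng]; split.
  exists (fun M => (cf M + cg M + 1)%N); first exact: poly_bound_add2.
  move=> M [m x] /= /andP[]; case: m => [|m] Mm Mx; rewrite /cost /= addn1 ltnS.
    by apply: leq_trans (leq_addr _ _); apply: Hf.
  by apply: leq_trans (leq_addl _ _); apply: Hg; rewrite /= (ltnW Mm).
move=> M [m x] /= /andP[]; case: m => [|m] Mm Mx; rewrite /result /=; first exact: nf.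
by apply: ng; rewrite /= (ltnW Mm).
Qed.

Lemma bnd_cons a M (y : den F a) (s : den F (List a)) :
  @bnd (List a) M (y :: s) -> bnd M y /\ bnd M s.
Proof. by move=> /= /andP[/ltnW-> /andP[-> ->]]. Qed.

Lemma good_listcase a b c (f : prog c b) (g : prog (Prod (Prod a (List a)) c) b) :
  good f -> good g -> good (PListCase f g).
Proof.
move=> [[cf Pf Hf] nf] [[cg Pg Hg] ng].
have E M (y : den F a) (s : den F (List a)) (x : den F c) :
    @bnd (List a) M (y :: s) -> bnd M x ->
    @bnd (Prod (Prod a (List a)) c) M ((y, s), x).
  by move=> /bnd_cons[My Ms] Mx; apply/andP; split=> //; apply/andP.
split; last first.
  move=> M [[|y s] x] /andP[Ms Mx]; rewrite /result /=; first exact: nf.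
  by apply: ng; apply: E.
exists (fun M => (cf M + cg M + 1)%N); first exact: poly_bound_add2.
move=> M [[|y s] x] /andP[Ms Mx]; rewrite /cost /= addn1 ltnS.
  by apply: leq_trans (leq_addr _ _); apply: Hf.
by apply: leq_trans (leq_addl _ _); apply: Hg; apply: E.
Qed.

Lemma result_natiter a (f : prog a a) n (x : den F a) :
  result (PNatIter f) (n, x) = iter n (result f) x.
Proof. by rewrite /result /=; elim: n => //= n ->. Qed.

Lemma good_natiter a (f : prog a a) : good f -> good (PNatIter f).
Proof.
move=> [[cf Pf Hf] nf]; split; last first.
  move=> M [n x] /= /andP[_ Mx]; rewrite result_natiter.
  by elim: n => //= n; apply: nf.
exists (fun M => 1 + M * (cf M).+1)%N.
  apply: poly_bound_add (poly_bound_const 1) _; apply: poly_bound_mul => //.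
    exact: poly_bound_id.
  apply: poly_bound_le (poly_bound_add Pf (poly_bound_const 1)) => M.
  by rewrite addn1.
move=> M [n x] /= /andP[Mn Mx].
apply: leq_trans (_ : 1 + n * (cf M).+1 <= _)%N; last first.
  by rewrite leq_add2l leq_mul2r Mn orbT.
have E m : (Defs.eval (PNatIter f) (m, x)).1 = iter m (result f) x.
  exact: result_natiter.
rewrite /cost; elim: n {Mn} => //= n IHn.
have := E n => /= ->; rewrite mulSn addnCA -addnS addnC leq_add //.
by rewrite ltnS; apply: Hf; elim: n {IHn} => //= n; apply: nf.
Qed.

Lemma result_listfold a b (f : prog (Prod a b) b) (s : seq (den F a)) (z : den F b) :
  result (PListFold f) (s, z) = foldl (fun acc y => result f (y, acc)) z s.
Proof.
rewrite /result /=; set c := 1%N; move: c.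
by elim: s z => //= y s IHs z c; rewrite IHs.
Qed.

Lemma cost_listfold a b (f : prog (Prod a b) b) (I : den F b -> bool)
    (good_elt : den F a -> bool) C (s : seq (den F a)) z :
  (forall y acc, good_elt y -> I acc ->
     I (result f (y, acc)) /\ (cost f (y, acc) <= C)%N) ->
  all good_elt s -> I z -> (cost (PListFold f) (s, z) <= 1 + size s * C.+1)%N.
Proof.
move=> step; rewrite /cost /= -[X in (_ <= X + _)%N]/(z, 1%N).2.
move: (1%N) => c; elim: s z c => [|y s IHs] z c /=; first by rewrite addn0.
case/andP=> gy gs Iz; have [Iz' Cz] := step y z gy Iz.
apply: leq_trans (IHs _ _ gs Iz') _ => /=.
by rewrite mulSn addnA leq_add2r addnS ltnS leq_add2l.
Qed.

Lemma poly_cost_fold_bound f :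
  poly_bound f -> poly_bound (fun M => 1 + M * (f M).+1)%N.
Proof.
move=> Pf; apply: poly_bound_add (poly_bound_const 1) _; apply: poly_bound_mul.
  exact: poly_bound_id.
apply: poly_bound_le (poly_bound_add Pf (poly_bound_const 1)) => M.
by rewrite addn1.
Qed.

(** The invariant bounds the part of the accumulator on which the cost of the
    body depends; the rest may grow. *)
Lemma poly_cost_listfold a b (f : prog (Prod a b) b) (I : nat -> den F b -> bool) C :
  poly_bound C -> (forall M z, bnd M z -> I M z) ->
  (forall M y acc, bnd M y -> I M acc ->
     I M (result f (y, acc)) /\ (cost f (y, acc) <= C M)%N) ->
  poly_cost (PListFold f).
Proof.
move=> PC I0 step; exists (fun M => 1 + M * (C M).+1)%N.
  exact: poly_cost_fold_bound.
move=> M [s z] /= /andP[/andP[szs alls] Mz].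
apply: leq_trans (cost_listfold (step M) alls (I0 M z Mz)) _.
by rewrite leq_add2l leq_mul2r szs orbT.
Qed.

Lemma good_listfold a b (f : prog (Prod a b) b) : good f -> good (PListFold f).
Proof.
move=> [[cf Pf Hf] nf]; split.
  apply: (poly_cost_listfold (I := @bnd b) Pf) => // M y acc My Macc.
  by split; [apply: nf | apply: Hf]; rewrite /= My.
move=> M [s z] /= /andP[/andP[_ alls] Mz]; rewrite result_listfold.
elim: s z alls Mz => //= y s IHs z /andP[My Ms] Mz; apply: IHs => //.
by apply: nf; rewrite /= My.
Qed.

End Complexity.

(** * Combinators with contexts *)

(** Combinators and programs are locked with pairwise distinct keys, so that no
    rewriting rule for one of them matches another one up to unfolding. *)
Fact prog_key (n : nat) : unit. Proof. exact: tt. Qed.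

Definition v0 {a G : ty} : prog (Prod a G) a :=
  locked_with (prog_key 1)
  (PFst a G).
Definition sh {a G b : ty} (t : prog G b) : prog (Prod a G) b :=
  locked_with (prog_key 2)
  (PComp t (PSnd a G)).

(** In a nested pair read as a context, [vi] is the variable number [i], the
    innermost one being [v0]. *)
Notation v1 := (sh v0).
Notation v2 := (sh v1).
Notation v3 := (sh v2).
Notation v4 := (sh v3).
Notation v5 := (sh v4).
Notation v6 := (sh v5).
Notation v7 := (sh v6).

Definition erev {G a : ty} (s : prog G (List a)) : prog G (List a) :=
  locked_with (prog_key 3)
  (PComp (PListFold (PCons a)) (PPair s (PNil G a))).

Section Combinators.

Variables G a b : ty.

Definition elet (e : prog G a) (t : prog (Prod a G) b) : prog G b :=
  locked_with (prog_key 4)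
  (PComp t (PPair e (PId G))).
Definition ecall (f : prog a b) (e : prog G a) : prog G b :=
  locked_with (prog_key 5)
  (PComp f e).
Definition epair (e : prog G a) (f : prog G b) : prog G (Prod a b) :=
  locked_with (prog_key 6)
  (PPair e f).
Definition efst (e : prog G (Prod a b)) : prog G a :=
  locked_with (prog_key 7)
  (PComp (PFst a b) e).
Definition esnd (e : prog G (Prod a b)) : prog G b :=
  locked_with (prog_key 8)
  (PComp (PSnd a b) e).

Definition eif (e : prog G Bool) (f g : prog G b) : prog G b :=
  locked_with (prog_key 9)
  (PIf e f g).
Definition enot (e : prog G Bool) : prog G Bool :=
  locked_with (prog_key 10)
  (PIf e (PFalse G) (PTrue G)).
Definition eand (e f : prog G Bool) : prog G Bool :=
  locked_with (prog_key 11)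
  (PIf e f (PFalse G)).
Definition eor (e f : prog G Bool) : prog G Bool :=
  locked_with (prog_key 12)
  (PIf e (PTrue G) f).

Definition eadd (e f : prog G Scal) : prog G Scal :=
  locked_with (prog_key 13)
  (PComp PSAdd (PPair e f)).
Definition emul (e f : prog G Scal) : prog G Scal :=
  locked_with (prog_key 14)
  (PComp PSMul (PPair e f)).
Definition eopp (e : prog G Scal) : prog G Scal :=
  locked_with (prog_key 15)
  (PComp PSOpp e).
Definition eis0 (e : prog G Scal) : prog G Bool :=
  locked_with (prog_key 16)
  (PComp PSIsZero e).

Definition elcase (s : prog G (List a)) (f : prog G b)
    (g : prog (Prod (Prod a (List a)) G) b) : prog G b :=
  locked_with (prog_key 17)
  (PComp (PListCase f g) (PPair s (PId G))).
Definition ehd (d : prog G a) (s : prog G (List a)) : prog G a :=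
  locked_with (prog_key 18)
  (PComp (PListCase d (PComp (PFst a (List a)) (PFst _ G))) (PPair s (PId G))).
Definition etl (s : prog G (List a)) : prog G (List a) :=
  locked_with (prog_key 19)
  (PComp (PListCase (PNil G a) (PComp (PSnd a (List a)) (PFst _ G)))
        (PPair s (PId G))).

(** The primitive fold gives its body no access to the context, which is thus
    carried along in the accumulator. *)
Definition efold (s : prog G (List a)) (z : prog G b)
    (body : prog (Prod a (Prod b G)) b) : prog G b :=
  locked_with (prog_key 20)
  (PComp (PFst b G)
    (PComp (PListFold (PPair body (PComp (PSnd b G) (PSnd a _))))
           (PPair s (PPair z (PId G))))).

Definition eiter (n : prog G Nat) (z : prog G b) (body : prog (Prod b G) b) :
    prog G b :=
  locked_with (prog_key 21)
  (PComp (PFst b G)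
    (PComp (PNatIter (PPair body (PSnd b G))) (PPair n (PPair z (PId G))))).

(** The accumulator pairs the reversed list of the results with the context. *)
Definition mapf_body (p : prog (Prod a G) Bool) (t : prog (Prod a G) b) :
    prog (Prod a (Prod (List b) G)) (Prod (List b) G) :=
  let elt_env := PPair (PFst a (Prod (List b) G))
                       (PComp (PSnd (List b) G) (PSnd a (Prod (List b) G))) in
  PIf (PComp p elt_env)
      (PPair (PComp (PCons b) (PPair (PComp t elt_env)
                                     (PComp (PFst (List b) G) (PSnd a _))))
             (PComp (PSnd (List b) G) (PSnd a _)))
      (PSnd a _).

Definition emapf (s : prog G (List a)) (p : prog (Prod a G) Bool)
    (t : prog (Prod a G) b) : prog G (List b) :=
  locked_with (prog_key 22)
  (erev (PComp (PFst (List b) G)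
    (PComp (PListFold (mapf_body p t)) (PPair s (PPair (PNil G b) (PId G)))))).

End Combinators.

Section Derived.

Variables G a : ty.

Definition emap b (s : prog G (List a)) (t : prog (Prod a G) b) : prog G (List b) :=
  locked_with (prog_key 23)
  (emapf s (PTrue _) t).
Definition efilter (s : prog G (List a)) (p : prog (Prod a G) Bool) : prog G (List a) :=
  locked_with (prog_key 24)
  (emapf s p v0).
Definition ehas (s : prog G (List a)) (p : prog (Prod a G) Bool) : prog G Bool :=
  locked_with (prog_key 25)
  (elcase (efilter s p) (PFalse G) (PTrue _)).
Definition eall (s : prog G (List a)) (p : prog (Prod a G) Bool) : prog G Bool :=
  locked_with (prog_key 26)
  (enot (ehas s (enot p))).

Definition esize_iota (s : prog G (List a)) : prog G (Prod Nat (List Nat)) :=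
  locked_with (prog_key 27)
  (PComp (PListFold (PPair (PComp PSucc (PComp (PFst _ _) (PSnd a _)))
                          (PComp (PCons Nat) (PSnd a _))))
        (PPair s (PPair (PZero G) (PNil G Nat)))).
Definition esize (s : prog G (List a)) : prog G Nat :=
  locked_with (prog_key 28)
  (efst (esize_iota s)).
Definition eidx (s : prog G (List a)) : prog G (List Nat) :=
  locked_with (prog_key 29)
  (erev (esnd (esize_iota s))).

Definition enth (d : prog G a) (s : prog G (List a)) (i : prog G Nat) : prog G a :=
  locked_with (prog_key 30)
  (ehd d (eiter i s (etl v0))).

Definition esucc (n : prog G Nat) : prog G Nat :=
  locked_with (prog_key 31)
  (PComp PSucc n).
Definition epred (n : prog G Nat) : prog G Nat :=
  locked_with (prog_key 32)
  (PComp (PNatCase (PZero G) (PFst Nat G)) (PPair n (PId G))).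
Definition eisz (n : prog G Nat) : prog G Bool :=
  locked_with (prog_key 33)
  (PComp (PNatCase (PTrue G) (PFalse _)) (PPair n (PId G))).
End Derived.

Section Derived2.

Variables G a b : ty.

Definition esub (m n : prog G Nat) : prog G Nat :=
  locked_with (prog_key 34)
  (eiter n m (epred v0)).
Definition eeqn (m n : prog G Nat) : prog G Bool :=
  locked_with (prog_key 35)
  (eand (eisz (esub m n)) (eisz (esub n m))).

(** Each element of [s] removes one from [t]. *)
Definition elesize (s : prog G (List a)) (t : prog G (List b)) : prog G Bool :=
  locked_with (prog_key 36)
  (elcase (efold s t (etl v1)) (PTrue G) (PFalse _)).

End Derived2.

(* The simplification of [result] would run the programs symbolically. *)
#[global] Arguments result : simpl never.
#[global] Arguments cost : simpl never.

Section DerivedResults.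

Variable F : fieldType.
Implicit Types G a b c : ty.

Lemma result_comp a b c (g : prog b c) (f : prog a b) (x : den F a) :
  result (PComp g f) x = result g (result f x).
Proof. by []. Qed.

Lemma result_pair a b c (f : prog a b) (g : prog a c) (x : den F a) :
  result (PPair f g) x = (result f x, result g x).
Proof. by []. Qed.

Lemma result_id a (x : den F a) : result (PId a) x = x.
Proof. by []. Qed.

Lemma result_v0 a G (y : den F a) (g : den F G) : result v0 ((y, g) : den F (Prod a G)) = y.
Proof. by rewrite /v0 unlock. Qed.

Lemma result_sh a b G (t : prog G b) (y : den F a) (g : den F G) :
  result (sh t) ((y, g) : den F (Prod a G)) = result t g.
Proof. by rewrite /sh unlock. Qed.

Lemma result_elet a b G (e : prog G a) (t : prog (Prod a G) b) (g : den F G) :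
  result (elet e t) g = result t ((result e g, g) : den F (Prod a G)).
Proof. by rewrite /elet unlock. Qed.

Lemma result_ecall a b G (f : prog a b) (e : prog G a) (g : den F G) :
  result (ecall f e) g = result f (result e g).
Proof. by rewrite /ecall unlock. Qed.

Lemma result_epair a b G (e : prog G a) (f : prog G b) (g : den F G) :
  result (epair e f) g = (result e g, result f g).
Proof. by rewrite /epair unlock. Qed.

Lemma result_efst a b G (e : prog G (Prod a b)) (g : den F G) :
  result (efst e) g = (result e g).1.
Proof. by rewrite /efst unlock. Qed.

Lemma result_esnd a b G (e : prog G (Prod a b)) (g : den F G) :
  result (esnd e) g = (result e g).2.
Proof. by rewrite /esnd unlock. Qed.

Lemma result_eif b G (e : prog G Bool) (f h : prog G b) (g : den F G) :
  result (eif e f h) g = if result e g then result f g else result h g.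
Proof. by rewrite /eif unlock; apply: result_if. Qed.

Lemma result_enot G (e : prog G Bool) (g : den F G) :
  result (enot e) g = ~~ result e g :> bool.
Proof. by rewrite /enot unlock result_if; case: (result e g). Qed.

Lemma result_eand G (e f : prog G Bool) (g : den F G) :
  result (eand e f) g = result e g && result f g :> bool.
Proof. by rewrite /eand unlock result_if; case: (result e g). Qed.

Lemma result_eor G (e f : prog G Bool) (g : den F G) :
  result (eor e f) g = result e g || result f g :> bool.
Proof. by rewrite /eor unlock result_if; case: (result e g). Qed.

Lemma result_eadd G (e f : prog G Scal) (g : den F G) :
  result (eadd e f) g = (result e g : F) + result f g.
Proof. by rewrite /eadd unlock. Qed.

Lemma result_emul G (e f : prog G Scal) (g : den F G) :
  result (emul e f) g = (result e g : F) * result f g.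
Proof. by rewrite /emul unlock. Qed.

Lemma result_eopp G (e : prog G Scal) (g : den F G) :
  result (eopp e) g = - (result e g : F).
Proof. by rewrite /eopp unlock. Qed.

Lemma result_eis0 G (e : prog G Scal) (g : den F G) :
  result (eis0 e) g = ((result e g : F) == 0).
Proof. by rewrite /eis0 unlock. Qed.

Lemma result_elcase a b G (s : prog G (List a)) (f : prog G b) h (g : den F G) :
  result (elcase s f h) g =
  if (result s g : seq (den F a)) is y :: s'
  then result h (((y, s'), g) : den F (Prod (Prod a (List a)) G)) else result f g.
Proof. by rewrite /elcase unlock /result /=; case: (Defs.eval s g).1. Qed.

Lemma result_ehd a G (d : prog G a) (s : prog G (List a)) (g : den F G) :
  result (ehd d s) g = head (result d g) (result s g).
Proof. by rewrite /ehd unlock /result /=; case: (Defs.eval s g).1. Qed.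

Lemma result_etl a G (s : prog G (List a)) (g : den F G) :
  result (etl s) g = behead (result s g : seq (den F a)).
Proof. by rewrite /etl unlock /result /=; case: (Defs.eval s g).1. Qed.

Lemma result_efold a b G (s : prog G (List a)) (z : prog G b) body (g : den F G) :
  result (efold s z body) g =
  foldl (fun (acc : den F b) (y : den F a) =>
           result body ((y, (acc, g)) : den F (Prod a (Prod b G)))) (result z g) (result s g).
Proof.
rewrite /efold unlock result_comp result_comp !result_pair.
rewrite result_listfold; elim: (result s g : seq (den F a)) (result z g) => // y s' IHs z'.
exact: IHs.
Qed.

Lemma result_eiter b G (n : prog G Nat) (z : prog G b) body (g : den F G) :
  result (eiter n z body) g =
  iter (result n g) (fun acc : den F b => result body ((acc, g) : den F (Prod b G))) (result z g).
Proof.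
rewrite /eiter unlock result_comp result_comp !result_pair result_natiter.
set f := fun acc => _.
have E m : iter m (result (PPair body (PSnd b G)))
    ((result z g, result (PId G) g) : den F (Prod b G)) = (iter m f (result z g), g).
  by elim: m => //= m ->.
by rewrite E.
Qed.

Lemma result_erev a G (s : prog G (List a)) (g : den F G) :
  result (erev s) g = rev (result s g : seq (den F a)).
Proof.
rewrite /erev unlock result_comp result_pair result_listfold.
rewrite /rev -[result (PNil _ _) _]/[::].
by elim: (result s g : seq (den F a)) ([::] : seq (den F a)) => // y s' IHs l; apply: IHs.
Qed.

Lemma result_mapf_fold a b G (p : prog (Prod a G) Bool) (t : prog (Prod a G) b)
    (s : seq (den F a)) (l : seq (den F b)) (g : den F G) :
  result (PListFold (mapf_body p t))
    (s, ((l, g) : den F (Prod (List b) G))) =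
  (catrev [seq result t ((y, g) : den F (Prod a G))
           | y : den F a <- s & result p ((y, g) : den F (Prod a G))] l, g).
Proof.
rewrite result_listfold; elim: s l => //= y s IHs l.
have -> : result (mapf_body p t) (y, (l, g)) =
    if result p ((y, g) : den F (Prod a G))
    then (result t ((y, g) : den F (Prod a G)) :: l, g) else (l, g).
  exact: result_if.
by case: (result p _) => /=; rewrite IHs.
Qed.

Lemma result_emapf a b G (s : prog G (List a)) (p : prog (Prod a G) Bool)
    (t : prog (Prod a G) b) (g : den F G) :
  result (emapf s p t) g =
  [seq result t ((y, g) : den F (Prod a G))
  | y : den F a <- (result s g : seq (den F a)) & result p ((y, g) : den F (Prod a G))].
Proof.
rewrite /emapf unlock result_erev !result_comp !result_pair.
by rewrite result_mapf_fold /= -/(rev _) revK.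
Qed.

Lemma result_emap a b G (s : prog G (List a)) (t : prog (Prod a G) b) (g : den F G) :
  result (emap s t) g =
  [seq result t ((y, g) : den F (Prod a G)) | y : den F a <- (result s g : seq (den F a))].
Proof. by rewrite /emap unlock result_emapf filter_predT. Qed.

Lemma result_efilter a G (s : prog G (List a)) p (g : den F G) :
  result (efilter s p) g =
  [seq y : den F a <- (result s g : seq (den F a))
  | result p ((y, g) : den F (Prod a G))].
Proof.
rewrite /efilter unlock result_emapf.
by under eq_map => y do rewrite result_v0; rewrite map_id.
Qed.

Lemma result_ehas a G (s : prog G (List a)) p (g : den F G) :
  result (ehas s p) g =
  has (fun y : den F a => result p ((y, g) : den F (Prod a G)))
    (result s g : seq (den F a)).
Proof.
rewrite /ehas unlock result_elcase result_efilter has_count -size_filter.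
by case: (seq.filter _ _).
Qed.

Lemma result_eall a G (s : prog G (List a)) p (g : den F G) :
  result (eall s p) g =
  all (fun y : den F a => result p ((y, g) : den F (Prod a G)))
    (result s g : seq (den F a)).
Proof.
rewrite /eall unlock result_enot result_ehas -all_predC; apply: eq_all => y.
by rewrite /= result_enot negbK.
Qed.

Lemma result_esize_iota a G (s : prog G (List a)) (g : den F G) :
  result (esize_iota s) g =
  (size (result s g : seq (den F a)), rev (iota 0 (size (result s g : seq (den F a))))).
Proof.
rewrite /esize_iota unlock result_comp !result_pair result_listfold.
set f := fun acc y => _.
have E (t : seq (den F a)) i : foldl f (i, rev (iota 0 i)) t =
    ((i + size t)%N, rev (iota 0 (i + size t)%N)).
  elim: t i => [|y t IHt] i /=; first by rewrite addn0.
  rewrite -[f _ _]/(i.+1, i :: rev (iota 0 i)).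
  have -> : i :: rev (iota 0 i) = rev (iota 0 i.+1).
    by rewrite -[i.+1]addn1 iotaD rev_cat.
  by rewrite IHt addSnnS.
exact: E.
Qed.

Lemma result_esize a G (s : prog G (List a)) (g : den F G) :
  result (esize s) g = size (result s g : seq (den F a)).
Proof. by rewrite /esize unlock result_efst result_esize_iota. Qed.

Lemma result_eidx a G (s : prog G (List a)) (g : den F G) :
  result (eidx s) g = iota 0 (size (result s g : seq (den F a))).
Proof. by rewrite /eidx unlock result_erev result_esnd result_esize_iota /= revK. Qed.

Lemma result_enth a G (d : prog G a) (s : prog G (List a)) i (g : den F G) :
  result (enth d s i) g = nth (result d g) (result s g) (result i g).
Proof.
rewrite /enth unlock result_ehd result_eiter.
set f := fun acc => _; have Ef t : f t = behead t by rewrite /f result_etl result_v0.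
have -> : iter (result i g) f (result s g) = drop (result i g) (result s g).
  elim: (result i g : nat) => [|m IHm]; first by rewrite drop0.
  by rewrite iterS IHm Ef -drop1 drop_drop add1n.
by rewrite -nth0 nth_drop addn0.
Qed.

Lemma result_esucc G (n : prog G Nat) (g : den F G) :
  result (esucc n) g = (result n g : nat).+1.
Proof. by rewrite /esucc unlock. Qed.

Lemma result_epred G (n : prog G Nat) (g : den F G) :
  result (epred n) g = (result n g : nat).-1.
Proof. by rewrite /epred unlock /result /=; case: (Defs.eval n g).1. Qed.

Lemma result_eisz G (n : prog G Nat) (g : den F G) :
  result (eisz n) g = (result n g == 0 :> nat).
Proof. by rewrite /eisz unlock /result /=; case: (Defs.eval n g).1. Qed.

Lemma result_esub G (m n : prog G Nat) (g : den F G) :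
  result (esub m n) g = (result m g - result n g)%N.
Proof.
rewrite /esub unlock result_eiter; elim: (result n g : nat) => [|i IHi]; first by rewrite subn0.
by rewrite iterS IHi result_epred result_v0 subnS.
Qed.

Lemma result_eeqn G (m n : prog G Nat) (g : den F G) :
  result (eeqn m n) g = (result m g == result n g :> nat).
Proof. by rewrite /eeqn unlock result_eand !result_eisz !result_esub !subn_eq0 eqn_leq. Qed.

Lemma result_elesize a b G (s : prog G (List a)) (t : prog G (List b)) (g : den F G) :
  result (elesize s t) g =
  (size (result t g : seq (den F b)) <= size (result s g : seq (den F a)))%N.
Proof.
rewrite /elesize unlock result_elcase result_efold.
have E (u : seq (den F a)) (v : seq (den F b)) :
    foldl (fun (acc : den F (List b)) (y : den F a) =>
        result (etl v1) ((y, (acc, g)) : den F (Prod a (Prod (List b) G)))) v u =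
    drop (size u) v.
  elim: u v => [|y u IHu] v /=; first by rewrite drop0.
  by rewrite result_etl result_sh result_v0 -drop1 IHu drop_drop addn1.
rewrite E; move: (result s g : seq _) (result t g : seq _) => u v.
rewrite -subn_eq0 -size_drop; by case: (drop _ _).
Qed.

Lemma result_const G (g : den F G) :
  ((result (PTrue G) g = true) * (result (PFalse G) g = false) *
   (result (PS0 G) g = 0 :> F) * (result (PS1 G) g = 1 :> F) *
   (result (PZero G) g = 0%N))%type.
Proof. by []. Qed.

Lemma result_nil G a (g : den F G) : result (PNil G a) g = [::].
Proof. by []. Qed.

Definition resultE := (result_id, result_v0, result_sh, result_elet, result_ecall,
  result_epair, result_efst, result_esnd, result_eif, result_enot, result_eand,
  result_eor, result_eadd, result_emul, result_eopp, result_eis0, result_elcase,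
  result_ehd, result_etl, result_efold, result_eiter, result_emapf, result_emap,
  result_efilter, result_ehas, result_eall, result_esize, result_eidx,
  result_enth, result_esucc, result_eeqn, result_elesize, result_const, result_nil).

End DerivedResults.

(** Constants are opaque for these hints: a combinator is recognised by its
    name only. *)
Create HintDb good discriminated.
#[global] Hint Constants Opaque : good.
#[global] Hint Resolve good_comp good_pair good_if good_id good_unit good_fst good_snd
  good_true good_false good_zero good_nil good_s0 good_s1 good_sadd good_sopp
  good_smul good_siszero good_natcase good_listcase good_natiter good_listfold
  : good.

Ltac good := solve [auto 200 with nocore good].

Section DerivedGood.

Variable F : fieldType.
Implicit Types G a b c : ty.
Local Notation good := (@good F _ _).
Local Notation tame := (@tame F _ _).

Lemma good_v0 a G : good (@v0 a G). Proof. by rewrite /v0 unlock; apply: good_fst. Qed.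

Lemma good_sh a b G (t : prog G b) : good t -> good (@sh a G b t).
Proof. by rewrite /sh unlock => gt; apply: good_comp (good_snd _ _ _). Qed.

Lemma good_elet a b G (e : prog G a) (t : prog (Prod a G) b) :
  good e -> good t -> good (elet e t).
Proof. by rewrite /elet unlock => *; good. Qed.

Lemma tame_elet a b G (e : prog G a) (t : prog (Prod a G) b) :
  tame e -> tame t -> tame (elet e t).
Proof.
rewrite /elet unlock => te tt; apply: tame_comp => //; apply: tame_pair => //.
exact: good_tame (good_id _ _).
Qed.

Lemma good_ecall a b G (f : prog a b) (e : prog G a) :
  good f -> good e -> good (ecall f e).
Proof. by rewrite /ecall unlock; apply: good_comp. Qed.

Lemma good_epair a b G (e : prog G a) (f : prog G b) :
  good e -> good f -> good (epair e f).
Proof. by rewrite /epair unlock; apply: good_pair. Qed.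

Lemma good_efst a b G (e : prog G (Prod a b)) : good e -> good (efst e).
Proof. by rewrite /efst unlock => *; good. Qed.
Lemma good_esnd a b G (e : prog G (Prod a b)) : good e -> good (esnd e).
Proof. by rewrite /esnd unlock => *; good. Qed.
Lemma good_eif b G (e : prog G Bool) (f g : prog G b) :
  good e -> good f -> good g -> good (eif e f g).
Proof. by rewrite /eif unlock; apply: good_if. Qed.
Lemma good_enot G (e : prog G Bool) : good e -> good (enot e).
Proof. by rewrite /enot unlock => *; good. Qed.
Lemma good_eand G (e f : prog G Bool) : good e -> good f -> good (eand e f).
Proof. by rewrite /eand unlock => *; good. Qed.
Lemma good_eor G (e f : prog G Bool) : good e -> good f -> good (eor e f).
Proof. by rewrite /eor unlock => *; good. Qed.
Lemma good_eadd G (e f : prog G Scal) : good e -> good f -> good (eadd e f).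
Proof. by rewrite /eadd unlock => *; good. Qed.
Lemma good_emul G (e f : prog G Scal) : good e -> good f -> good (emul e f).
Proof. by rewrite /emul unlock => *; good. Qed.
Lemma good_eopp G (e : prog G Scal) : good e -> good (eopp e).
Proof. by rewrite /eopp unlock => *; good. Qed.
Lemma good_eis0 G (e : prog G Scal) : good e -> good (eis0 e).
Proof. by rewrite /eis0 unlock => *; good. Qed.
Lemma good_elcase a b G (s : prog G (List a)) (f : prog G b) g :
  good s -> good f -> good g -> good (elcase s f g).
Proof. by rewrite /elcase unlock => *; good. Qed.
Lemma good_ehd a G (d : prog G a) s : good d -> good s -> good (ehd d s).
Proof. by rewrite /ehd unlock => *; good. Qed.
Lemma good_etl a G (s : prog G (List a)) : good s -> good (etl s).
Proof. by rewrite /etl unlock => *; good. Qed.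
Lemma good_efold a b G (s : prog G (List a)) (z : prog G b) body :
  good s -> good z -> good body -> good (efold s z body).
Proof. by rewrite /efold unlock => *; good. Qed.
Lemma good_eiter b G (n : prog G Nat) (z : prog G b) body :
  good n -> good z -> good body -> good (eiter n z body).
Proof. by rewrite /eiter unlock => *; good. Qed.

(** The body of the fold has a constant cost, whatever the length of the list
    under construction. *)
Lemma poly_cost_erev a G (s : prog G (List a)) :
  tame s -> poly_cost F (erev s).
Proof.
rewrite /erev unlock => ts; apply: poly_cost_comp; last first.
  by apply: tame_pair => //; apply: good_tame (good_nil _ _ _).
by apply: (poly_cost_listfold (I := fun _ _ => true) (poly_bound_const 1)).
Qed.

Lemma bnd_list a M (s : seq (den F a)) :
  @bnd F (List a) M s = (size s <= M)%N && all (bnd M) s.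
Proof. by []. Qed.

Lemma bnd_pair a b M (x : den F a) (y : den F b) :
  @bnd F (Prod a b) M (x, y) = bnd M x && bnd M y.
Proof. by []. Qed.

Lemma tame_erev a G (s : prog G (List a)) : tame s -> tame (erev s).
Proof.
move=> ts; split; first exact: poly_cost_erev.
have [_ [f Pf Hf]] := ts; exists f => // M x Mx.
by rewrite result_erev bnd_list size_rev all_rev; apply: Hf.
Qed.

Lemma tame_mapf_fold a b G p (t : prog (Prod a G) b) : tame p -> tame t ->
  tame (PListFold (mapf_body p t)).
Proof.
move=> [[cp Pp Hp] _] [[ct Pt Ht] [st Ps Hs]]; split.
  apply: (poly_cost_listfold (b := Prod (List b) G)
    (I := fun M (z : den F (Prod (List b) G)) => bnd M z.2)
    (* 30 is more than the cost of the projections and pairs of the body *)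
    (poly_bound_add2 30 Pp Pt)) => [M z /andP[]// | M y [l g] My Mg].
  have Myg : @bnd F (Prod a G) M (y, g) by apply/andP.
  rewrite /mapf_body result_if; split; first by case: ifP.
  have := Hp M (y, g) Myg; have := Ht M (y, g) Myg; rewrite /cost /=.
  move: (Defs.eval p (y, g)) (Defs.eval t (y, g)) => [rp kp] [rt kt] /= let_ lep.
  by case: rp => /=; lia.
exists (fun M => M + M + st M)%N.
  by apply: poly_bound_add => //; apply: poly_bound_add; apply: poly_bound_id.
move=> M [s [l g]] /andP[/andP[szs als] /andP[/andP[szl all_l] Mg]].
rewrite /= in szs als szl all_l Mg; rewrite result_mapf_fold bnd_pair.
apply/andP; split; last first.
  by apply: bnd_le Mg; rewrite -addnA leq_addr.
rewrite bnd_list catrevE size_cat size_rev size_map all_cat all_rev.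
apply/andP; split.
  apply: leq_trans (leq_addr _ _); rewrite leq_add //.
  by apply: leq_trans szs; rewrite size_filter count_size.
apply/andP; split; last first.
  by apply: sub_all all_l => z; apply: bnd_le; rewrite -addnA leq_addr.
elim: s als {szs} => //= y s IHs /andP[My Ms]; case: ifP => _; last exact: IHs.
rewrite map_cons /= IHs // andbT; apply: bnd_le (Hs M (y, g) _); first exact: leq_addl.
by apply/andP.
Qed.

Lemma tame_emapf a b G (s : prog G (List a)) p (t : prog (Prod a G) b) :
  tame s -> tame p -> tame t -> tame (emapf s p t).
Proof.
rewrite /emapf unlock => ts tp tt; apply: tame_erev; apply: tame_comp.
  exact: good_tame (good_fst _ _ _).
apply: tame_comp; first exact: tame_mapf_fold.
by apply: tame_pair => //; apply: good_tame; good.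
Qed.

Lemma good_emapf a b G (s : prog G (List a)) p (t : prog (Prod a G) b) :
  good s -> good p -> good t -> good (emapf s p t).
Proof.
move=> gs gp gt; split; first by apply: (tame_emapf _ _ _).1; apply: good_tame.
move=> M g Mg; rewrite result_emapf bnd_list size_map.
have /andP[szs als] := gs.2 M g Mg.
rewrite (leq_trans _ szs) ?size_filter ?count_size //=.
elim: (result s g : seq _) als {szs} => //= y l IHl /andP[My Ml].
case: ifP => //= _; last exact: IHl.
by rewrite IHl // andbT; apply: gt.2; apply/andP.
Qed.

Lemma good_emap a b G (s : prog G (List a)) (t : prog (Prod a G) b) :
  good s -> good t -> good (emap s t).
Proof. by rewrite /emap unlock => gs gt; apply: good_emapf => //; apply: good_true. Qed.

Lemma tame_emap a b G (s : prog G (List a)) (t : prog (Prod a G) b) :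
  tame s -> tame t -> tame (emap s t).
Proof.
by rewrite /emap unlock => gs gt; apply: tame_emapf => //; apply: good_tame (good_true _ _).
Qed.

Lemma good_efilter a G (s : prog G (List a)) p :
  good s -> good p -> good (efilter s p).
Proof. by rewrite /efilter unlock => gs gp; apply: good_emapf => //; apply: good_v0. Qed.

Lemma good_ehas a G (s : prog G (List a)) p : good s -> good p -> good (ehas s p).
Proof.
rewrite /ehas unlock => gs gp; apply: good_elcase; first exact: good_efilter.
  exact: good_false.
exact: good_true.
Qed.

Lemma good_eall a G (s : prog G (List a)) p : good s -> good p -> good (eall s p).
Proof.
rewrite /eall unlock => gs gp; apply: good_enot; apply: good_ehas => //.
exact: good_enot.
Qed.

Lemma good_esize_iota a G (s : prog G (List a)) : good s -> good (esize_iota s).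
Proof.
move=> gs; split.
  rewrite /esize_iota unlock; apply: poly_cost_comp; last by apply: good_tame; good.
  by apply: (poly_cost_listfold (I := fun _ _ => true) (poly_bound_const 20)).
move=> M g Mg; rewrite result_esize_iota bnd_pair; have /andP[szs _] := gs.2 M g Mg.
apply/andP; split; first exact: szs.
rewrite bnd_list size_rev size_iota szs all_rev /=.
by apply/allP=> i; rewrite mem_iota add0n /= => /ltnW/leq_trans ->.
Qed.

Lemma good_esize a G (s : prog G (List a)) : good s -> good (esize s).
Proof. by rewrite /esize unlock => gs; apply: good_efst; apply: good_esize_iota. Qed.

Lemma good_erev a G (s : prog G (List a)) : good s -> good (erev s).
Proof.
move=> gs; split; first exact: poly_cost_erev (good_tame gs).
move=> M g Mg; rewrite result_erev bnd_list size_rev all_rev.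
exact: gs.2.
Qed.

Lemma good_eidx a G (s : prog G (List a)) : good s -> good (eidx s).
Proof.
rewrite /eidx unlock => gs.
by apply: good_erev; apply: good_esnd; apply: good_esize_iota.
Qed.

Lemma good_enth a G (d : prog G a) s i :
  good d -> good s -> good i -> good (enth d s i).
Proof.
rewrite /enth unlock => gd gs gi; apply: good_ehd => //; apply: good_eiter => //.
by apply: good_etl; apply: good_v0.
Qed.

Lemma tame_esucc G (n : prog G Nat) : tame n -> tame (esucc n).
Proof. by rewrite /esucc unlock => tn; apply: tame_comp (tame_succ _) tn. Qed.

Lemma good_epred G (n : prog G Nat) : good n -> good (epred n).
Proof. by rewrite /epred unlock => *; good. Qed.

Lemma good_eisz G (n : prog G Nat) : good n -> good (eisz n).
Proof. by rewrite /eisz unlock => *; good. Qed.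

Lemma good_esub G (m n : prog G Nat) : good m -> good n -> good (esub m n).
Proof.
rewrite /esub unlock => gm gn; apply: good_eiter => //.
by apply: good_epred; apply: good_v0.
Qed.

Lemma good_eeqn G (m n : prog G Nat) : good m -> good n -> good (eeqn m n).
Proof.
rewrite /eeqn unlock => gm gn.
by apply: good_eand; apply: good_eisz; apply: good_esub.
Qed.

Lemma good_elesize a b G (s : prog G (List a)) (t : prog G (List b)) :
  good s -> good t -> good (elesize s t).
Proof.
rewrite /elesize unlock => gs gt; apply: good_elcase.
- by apply: good_efold => //; apply: good_etl; apply: good_sh; apply: good_v0.
- exact: good_true.
- exact: good_false.
Qed.

End DerivedGood.

#[global] Hint Resolve good_v0 good_sh good_elet good_ecall good_epair good_efst
  good_esnd good_eif good_enot good_eand good_eor good_eadd good_emul good_eopp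
  good_eis0 good_elcase good_ehd good_etl good_efold good_eiter good_emapf
  good_emap good_efilter good_ehas good_eall good_esize good_eidx good_enth
  good_eeqn good_elesize : good.

(** * Testing linear independence *)

Lemma foldl_iter (T U : Type) (f : T -> U -> T) (h : T -> T) (s : seq U) z :
  (forall x y, f x y = h x) -> foldl f z s = iter (size s) h z.
Proof. by move=> fh; elim: s z => //= y s IHs z; rewrite IHs fh -iterSr. Qed.

Section Independence.

Variable F : fieldType.

(** Division-free elimination: the rows of [W] lose their coordinate [j], and
    the relations between the rows remain the same up to the factor [v 0 j]. *)
Lemma row_free_eliminate (m k : nat) (v : 'rV[F]_k) (W : 'M[F]_(m, k)) j :
  v 0 j != 0 ->
  row_free (col_mx v W) = row_free (v 0 j *: W - col j W *m v).
Proof.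
move=> vj; apply/idP/idP=> /row_free_kerP H; apply/row_free_kerP.
  move=> b b0; have := H (row_mx (- (b *m col j W)) (v 0 j *: b)).
  rewrite mul_row_col mulNmx -mulmxA addrC -scalemxAl scalemxAr -mulmxBr => /(_ b0).
  move/(congr1 rsubmx); rewrite row_mxKr raddf0 => /eqP.
  by rewrite scaler_eq0 (negPf vj) => /eqP.
move=> c; rewrite -[c]hsubmxK mul_row_col; move: (lsubmx c) (rsubmx c) => a b E.
have Ej : b *m col j W = - (v 0 j *: a).
  have vd : v *m delta_mx j 0 = (v 0 j)%:M.
    by rewrite -colE; apply/matrixP=> x y; rewrite !ord1 !mxE eqxx.
  apply/eqP; rewrite colE mulmxA -addr_eq0 addrC -mul_mx_scalar -vd mulmxA.
  by rewrite -mulmxDl E mul0mx.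
have b0 : b = 0.
  apply: H; rewrite mulmxBr -scalemxAr mulmxA Ej mulNmx opprK -scalemxAl -scalerDr.
  by rewrite addrC E scaler0.
move: E; rewrite b0 mul0mx addr0 => /matrixP/(_ 0 j); rewrite !mxE.
rewrite big_ord1 => /eqP; rewrite mulf_eq0 (negPf vj) orbF => /eqP a0.
by rewrite (_ : a = 0) ?row_mx0 //; apply/matrixP=> x y; rewrite !ord1 a0 mxE.
Qed.

Definition mx_of (m k : nat) (rows : seq (seq F)) : 'M[F]_(m, k) :=
  \matrix_(i, j) nth 0 (nth [::] rows i) j.

Lemma mx_of_cons m k v rows :
  mx_of m.+1 k (v :: rows) =
    (col_mx (\row_j nth 0 v j) (mx_of m k rows) : 'M[F]_(1 + m, k)).
Proof.
apply/matrixP=> i j; rewrite [RHS]mxE; case: splitP => a Da; rewrite !mxE Da //.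
by rewrite ord1.
Qed.

(** The first vector is used to clear one coordinate of the others and dropped;
    the flag is cleared if that vector is zero. *)
Definition eliminate (acc : bool * seq (seq F)) : bool * seq (seq F) :=
  if acc.2 is v :: rest then
    if [seq j <- iota 0 (size v) | nth 0 v j != 0] is j :: _ then
      (acc.1, [seq [seq nth 0 v j * nth 0 w c - nth 0 w j * nth 0 v c
                   | c <- iota 0 (size v)] | w <- rest])
    else (false, rest)
  else acc.

Definition independent (rows : seq (seq F)) : bool :=
  (iter (size rows) eliminate (true, rows)).1.

Lemma independentE m k (rows : seq (seq F)) :
  size rows = m -> all (fun v => size v == k) rows ->
  independent rows = row_free (mx_of m k rows).
Proof.
move=> <-{m}; rewrite /independent -[RHS]/(true && _).
have [m Dm] : exists m, m = size rows by exists (size rows).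
rewrite -Dm; elim: m rows Dm true => [|m IHm] rows Dm ok szk.
  by rewrite /= [row_free _](_ : _ = true) ?andbT // /row_free -leqn0 rank_leq_row.
case: rows Dm szk => // v rows [Dm] /= /andP[/eqP szv szk].
rewrite -iterS iterSr {2}/eliminate /= mx_of_cons.
case Djs : [seq j <- iota 0 (size v) | nth 0 v j != 0] => [|j js].
  rewrite IHm //=; apply/esym/negbTE; rewrite negb_and.
  apply/orP; right; apply/negP=> freeM; 
  have H : forall c : 'rV[F]_(1 + m),
      c *m col_mx (\row_j nth 0 v j) (mx_of m k rows) = 0 -> c = 0.
    exact: (row_free_kerP _).1 freeM.
  have : row_mx 1 0 = 0 :> 'rV[F]_(1 + m).
    apply: H; rewrite mul_row_col mul0mx addr0 mul1mx; apply/rowP=> c; rewrite !mxE.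
    apply/eqP; apply: contraT => nz.
    have : (val c) \in [seq j <- iota 0 (size v) | nth 0 v j != 0].
      by rewrite mem_filter nz mem_iota szv /=.
    by rewrite Djs.
  move/(congr1 lsubmx)/matrixP/(_ 0 0); rewrite row_mxKl raddf0 !mxE => /eqP.
  by rewrite oner_eq0.
have : j \in [seq j <- iota 0 (size v) | nth 0 v j != 0].
  by rewrite Djs inE eqxx.
rewrite mem_filter mem_iota add0n szv /= => /andP[vj ltj].
rewrite IHm ?size_map //; last first.
  by rewrite all_map; apply/allP=> w _ /=; rewrite size_map size_iota.
congr (_ && _); rewrite (@row_free_eliminate _ _ _ _ (Ordinal ltj)) ?mxE //.
congr row_free; apply/matrixP=> a c; rewrite !mxE big_ord1 !mxE /=.
rewrite (nth_map [::]) -?Dm // (nth_map 0%N) ?size_iota ?szv //.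
by rewrite nth_iota ?szv.
Qed.

End Independence.

Definition eliminate_prog :
    prog (Prod Bool (Mat Scal)) (Prod Bool (Mat Scal)) := locked_with (prog_key 100)
  (elcase (esnd (PId _)) (PId _)
    (* in the context ((v, rest), acc) *)
    (elet (efst v0)
      (* in the context (v, ((v, rest), acc)) *)
      (elcase (efilter (eidx v0) (enot (eis0 (enth (PS0 _) v1 v0))))
        (epair (PFalse _) (esnd v1))
        (* in the context ((j, js), (v, ((v, rest), acc))) *)
        (elet (efst v0)
          (epair v4
            (emap (esnd v3)
              (* in the context (w, (j, (_, (v, _)))) *)
              (emap (eidx v3)
                (* in the context (c, (w, (j, (_, (v, _))))) *)
                (eadd (emul (enth (PS0 _) v4 v2) (enth (PS0 _) v1 v0))
                  (eopp (emul (enth (PS0 _) v1 v2) (enth (PS0 _) v4 v0))))))))))).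

Definition independent_prog : prog (Mat Scal) Bool := locked_with (prog_key 101)
  (efst (efold (PId _) (epair (PTrue _) (PId _)) (ecall eliminate_prog v1))).

Section IndependentProg.

Variable F : fieldType.

Lemma result_eliminate_prog (acc : bool * seq (seq F)) :
  result eliminate_prog (acc : den F (Prod Bool (Mat Scal))) = eliminate acc.
Proof.
case: acc => ok [|v rest]; first by rewrite /eliminate_prog unlock !resultE.
rewrite /eliminate_prog unlock result_elcase result_esnd result_id /= result_elet.
rewrite result_elcase result_efilter result_eidx /eliminate /=.
rewrite !result_v0 !result_efst !result_v0.
under eq_filter => y do rewrite !resultE.
set js := [seq _ <- _ | _].
case: js => [|j js]; first by rewrite !resultE.
rewrite !resultE /=; congr (_, _); apply: eq_map => w; rewrite !resultE.
by apply: eq_map => c; rewrite !resultE.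
Qed.

Lemma result_independent_prog (rows : seq (seq F)) :
  result independent_prog (rows : den F (Mat Scal)) = independent rows.
Proof.
rewrite /independent_prog unlock result_efst result_efold !resultE /independent.
congr (_.1); apply: foldl_iter => acc v.
by rewrite !resultE result_eliminate_prog.
Qed.

Lemma good_eliminate_prog : good F eliminate_prog.
Proof. by rewrite /eliminate_prog unlock; good. Qed.

Lemma good_independent_prog : good F independent_prog.
Proof.
rewrite /independent_prog unlock; have ? := good_eliminate_prog; good.
Qed.

End IndependentProg.

(** * The matching program *)

Notation v8 := (sh v7).
(** [wi] is the context without its first [i] variables. *)
Notation w1 := (sh (PId _)).
Notation w2 := (sh w1).
Notation w3 := (sh w2).
Notation w4 := (sh w3).
Notation w5 := (sh w4).

(** A state of the exchange algorithm: the basis vectors [V], the labels [S] of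
    their rows in [X] and the labels [U] of their columns. *)
Definition StTy : ty := Prod (Mat Scal) (Prod (List Nat) (List Nat)).

(** [(X, (Bbar, (l, (Ks, (Ns, (Ls, tt))))))], the last lists being the
    indices below [k], [n] and [l]. *)
Definition EnvTy : ty :=
  Prod (Mat Scal) (Prod (Mat Bool)
    (Prod Nat (Prod (List Nat) (Prod (List Nat) (Prod (List Nat) Unit))))).

(** In the context [(a, (s, (u, (st, E))))], where [E] stands for the variables of
    [EnvTy]. *)
Definition cand_prog :
    prog (Prod Nat (Prod Nat (Prod Nat (Prod StTy EnvTy)))) Bool :=
  locked_with (prog_key 102)
  (eand (enth (PFalse _) (enth (PNil _ _) v5 v1) v2)
    (ecall independent_prog
      (emap v7
        (eif (eeqn v0 v1) (enth (PNil _ _) v5 v2)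
          (enth (PNil _ _) (efst v4) v0))))).

(** In the context [(R, (st, E))], with a layer [R] given by its characteristic
    function. *)
Definition expand_prog :
    prog (Prod (List Bool) (Prod StTy EnvTy)) (List Bool) :=
  locked_with (prog_key 103)
  (emap v5
    (elet (enth (PZero _) (esnd (esnd v2)) v0)
      (eor (eeqn v0 v6)
        (ehas v8 (ehas v8
          (* in the context (a, (s, (u, (b, (R, (st, E)))))) *)
          (eand (enth (PFalse _) v4 v0)
            (ecall cand_prog (epair v0 (epair v1 (epair v2 w5)))))))))).

(** In the context [(a, (s, (u, (R, (st, E)))))]. *)
Definition hit_prog :
    prog (Prod Nat (Prod Nat (Prod Nat (Prod (List Bool) (Prod StTy EnvTy))))) Bool :=
  locked_with (prog_key 104)
  (eand (eall (esnd (esnd v4)) (enot (eeqn v0 v3)))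
    (eand (enth (PFalse _) v3 v0)
      (ecall cand_prog (epair v0 (epair v1 (epair v2 w4)))))).

(** In the context [(R, (st, E))].  The column and the row are determined first,
    by searches for the existence of the rest; the last loop returns the empty
    list if those searches failed, since it tests the default values too. *)
Definition search_prog :
    prog (Prod (List Bool) (Prod StTy EnvTy)) (List (Prod Nat (Prod Nat Nat))) :=
  locked_with (prog_key 105)
  (elet (ehd (PZero _) (efilter v7 (ehas v7 (ehas v7 hit_prog))))
    (elet (ehd (PZero _) (efilter v7 (ehas v7 hit_prog)))
      (emapf v7 hit_prog (epair v2 (epair v1 v0))))).

(** In the context [(st, E)].  The accumulator holds a layer and the exchanges
    found in the first layer that has some. *)
Definition first_exchange_prog :
    prog (Prod StTy EnvTy) (List (Prod Nat (Prod Nat Nat))) :=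
  locked_with (prog_key 106)
  (esnd (efold v4 (epair (emap v4 (PFalse _)) (PNil _ _))
    (elet (ecall expand_prog (epair (efst v1) w2))
      (epair v0
        (elcase (esnd v2) (ecall search_prog (epair v0 w3)) (esnd v3)))))).

(** In the context [(st, E)]. *)
Definition step_prog : prog (Prod StTy EnvTy) StTy :=
  locked_with (prog_key 107)
  (elcase first_exchange_prog v0
    (elet (efst v0)
      (* in the context ((u, (s, a)), (_, (st, E))) *)
      (epair (emap v6 (eif (eeqn v0 (esnd (esnd v1)))
                        (enth (PNil _ _) v4 (efst (esnd v1)))
                        (enth (PNil _ _) (efst v3) v0)))
        (epair (emap v6 (eif (eeqn v0 (esnd (esnd v1)))
                          (efst (esnd v1))
                          (enth (PZero _) (efst (esnd v3)) v0)))
               (emap v6 (eif (eeqn v0 (esnd (esnd v1)))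
                          (efst v1)
                          (enth (PZero _) (esnd (esnd v3)) v0))))))).

(** In the context [E]: the unit vectors, all of them artificial. *)
Definition init_prog : prog EnvTy StTy :=
  locked_with (prog_key 108)
  (epair (emap v3 (emap v4 (eif (eeqn v0 v1) (PS1 _) (PS0 _))))
    (epair (emap v3 (PZero _)) (emap v3 v3))).

(** In the context [E].  The initial measure is less than [k.+2 * k.+2], so that
    this number of steps suffices. *)
Definition basis_prog : prog EnvTy StTy :=
  locked_with (prog_key 109)
  (elet (esucc (esucc (esize v3)))
    (eiter v0 (ecall init_prog w1)
      (eiter v1 v0 (ecall step_prog (epair v0 w3))))).

(** In the context [(st, E)]. *)
Definition output_prog : prog (Prod StTy EnvTy)
    (Prod (Prod (List Nat) (List Nat)) (List (Prod Nat Nat))) :=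
  locked_with (prog_key 110)
  (epair (epair (efilter v5 (ehas (efst (esnd v1)) (eeqn v0 v1)))
                (efilter v6 (ehas (esnd (esnd v1)) (eeqn v0 v1))))
    (emap v4 (epair (enth (PZero _) (efst (esnd v1)) v0)
                    (enth (PZero _) (esnd (esnd v1)) v0)))).

(** In the context [(X, Bbar)]. *)
Definition env_prog : prog (Prod (Mat Scal) (Mat Bool)) EnvTy :=
  locked_with (prog_key 111)
  (epair v0 (epair w1 (epair (esize (ehd (PNil _ _) w1))
    (epair (eidx (ehd (PNil _ _) v0)) (epair (eidx w1)
      (epair (eidx (ehd (PNil _ _) w1)) (PUnit _))))))).

Definition mode_prog : prog (Prod (Mat Scal) (Mat Bool))
    (Prod (Prod (List Nat) (List Nat)) (List (Prod Nat Nat))) :=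
  locked_with (prog_key 112)
  (ecall (elet basis_prog output_prog) env_prog).

(** In the context [(A, (Xs, Bbar))]. *)
Definition step1_prog : prog InputTy ChoicesTy :=
  locked_with (prog_key 113)
  (emap v1 (ecall mode_prog (epair v0 w3))).

Ltac good_prog := unfold ChoicesTy, InputTy, EnvTy, StTy, Mat in *; good.

Section Step1Cost.

Variable F : fieldType.

Lemma good_cand_prog : good F cand_prog.
Proof. by rewrite /cand_prog unlock; have ? := good_independent_prog F; good_prog. Qed.

Lemma good_expand_prog : good F expand_prog.
Proof. by rewrite /expand_prog unlock; have ? := good_cand_prog; good_prog. Qed.

Lemma good_hit_prog : good F hit_prog.
Proof. by rewrite /hit_prog unlock; have ? := good_cand_prog; good_prog. Qed.

Lemma good_search_prog : good F search_prog.
Proof. by rewrite /search_prog unlock; have ? := good_hit_prog; good_prog. Qed.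

Lemma good_first_exchange_prog : good F first_exchange_prog.
Proof.
rewrite /first_exchange_prog unlock.
by have ? := good_search_prog; have ? := good_expand_prog; good_prog.
Qed.

Lemma good_step_prog : good F step_prog.
Proof. by rewrite /step_prog unlock; have ? := good_first_exchange_prog; good_prog. Qed.

Lemma good_init_prog : good F init_prog.
Proof. by rewrite /init_prog unlock; good_prog. Qed.

Lemma tame_basis_prog : tame F basis_prog.
Proof.
rewrite /basis_prog unlock; apply: tame_elet.
  by apply: tame_esucc; apply: tame_esucc; apply: good_tame; good_prog.
have ? := good_init_prog; have ? := good_step_prog.
by apply: good_tame; good_prog.
Qed.

Lemma tame_mode_prog : tame F mode_prog.
Proof.
rewrite /mode_prog unlock /ecall unlock; apply: tame_comp.
  apply: tame_elet; first exact: tame_basis_prog.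
  by rewrite /output_prog unlock; apply: good_tame; good_prog.
by rewrite /env_prog unlock; apply: good_tame; good_prog.
Qed.

Lemma tame_step1_prog : tame F step1_prog.
Proof.
rewrite /step1_prog unlock; apply: tame_emap; first by apply: good_tame; good_prog.
rewrite /ecall unlock; apply: tame_comp; first exact: tame_mode_prog.
by apply: good_tame; good_prog.
Qed.

End Step1Cost.

(** * Correctness of the matching program *)

Lemma iota_ord (n : nat) : iota 0 n = [seq val i | i <- enum 'I_n].
Proof. by rewrite val_enum_ord. Qed.

Lemma has_iota (n : nat) (p : pred nat) : has p (iota 0 n) = [exists i : 'I_n, p i].
Proof.
apply/hasP/existsP=> [[j lej pj] | [j pj]].
  by rewrite mem_iota in lej; exists (Ordinal lej).
by exists (val j) => //; rewrite mem_iota ltn_ord.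
Qed.

Lemma all_nth_ord (T : Type) (x0 : T) (k : nat) (s : seq T) (p : pred T) :
  size s = k -> all p s = [forall i : 'I_k, p (nth x0 s i)].
Proof.
move=> <-; apply/(all_nthP x0)/forallP=> [H i | H i lti]; first exact: H.
exact: (H (Ordinal lti)).
Qed.

Lemma nth_map_iota (T : Type) (x0 : T) (f : nat -> T) (k : nat) (i : 'I_k) :
  nth x0 [seq f j | j <- iota 0 k] i = f i.
Proof. by rewrite (nth_map 0%N) ?size_iota // nth_iota. Qed.

Lemma nth_enc_mx (T : Type) (x0 : T) (m n : nat) (M : 'M[T]_(m, n)) (i : 'I_m) (j : 'I_n) :
  nth x0 (nth [::] (enc_mx M) i) j = M i j.
Proof.
rewrite /enc_mx (nth_map i) ?size_enum_ord // (nth_map j) ?size_enum_ord //.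
by rewrite !nth_ord_enum.
Qed.

Lemma size_enc_mx (T : Type) (m n : nat) (M : 'M[T]_(m, n)) : size (enc_mx M) = m.
Proof. by rewrite size_map size_enum_ord. Qed.

Lemma size_nth_enc_mx (T : Type) (m n : nat) (M : 'M[T]_(m, n)) i :
  (i < m)%N -> size (nth [::] (enc_mx M) i) = n.
Proof.
by move=> lti; rewrite (nth_map (Ordinal lti)) ?size_enum_ord // size_map size_enum_ord.
Qed.

Section Step1Spec.

Variables (F : fieldType) (n l k : nat) (X : 'M[F]_(n, k)) (Bb : 'M[bool]_(n, l)).

Definition env : den F EnvTy :=
  (enc_mx X, (enc_mx Bb, (l, (iota 0 k, (iota 0 n, (iota 0 l, tt)))))).

Definition xvec (s : nat) : 'rV[F]_k := \row_j nth 0 (nth [::] (enc_mx X) s) j.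
Definition bnat (s u : nat) : bool := nth false (nth [::] (enc_mx Bb) s) u.

Lemma bnat_range s u : bnat s u -> (s < n)%N /\ (u < l)%N.
Proof.
rewrite /bnat; have [lts | les] := ltnP s n; last first.
  by rewrite [nth [::] _ _]nth_default ?nth_nil // size_enc_mx.
have [ltu // | leu] := ltnP u l.
by rewrite nth_default // size_nth_enc_mx.
Qed.

Definition wf_state (st : den F StTy) : Prop :=
  [/\ size st.1 = k, all (fun v : seq F => size v == k) st.1,
      size st.2.1 = k & size st.2.2 = k].

Definition state_mx (st : den F StTy) : 'M[F]_k := mx_of k k st.1.
Definition slabel (st : den F StTy) : 'I_k -> nat := fun b => nth 0%N st.2.1 b.
Definition ulabel (st : den F StTy) : 'I_k -> nat := fun b => nth 0%N st.2.2 b.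

Lemma result_cand_prog (st : den F StTy) (a : 'I_k) (s u : nat) : wf_state st ->
  result cand_prog ((val a, (s, (u, (st, env)))) :
    den F (Prod Nat (Prod Nat (Prod Nat (Prod StTy EnvTy))))) =
  cand xvec bnat (state_mx st) u s a.
Proof.
case: st => V [Sl Ul] [/= szV szVk _ _].
rewrite /cand_prog unlock !resultE result_independent_prog /cand -/(bnat s u) /=.
case bsu : (bnat s u) => //=; have [lts _] := bnat_range bsu.
rewrite (@independentE _ k k) ?size_map ?size_iota //; last first.
  rewrite all_map; apply/allP=> c; rewrite mem_iota add0n /= => ltc.
  rewrite !resultE /=; case: ifP => _; first by rewrite size_nth_enc_mx.
  by apply: (allP szVk); rewrite mem_nth ?szV.
rewrite row_free_unit; congr (_ \in unitmx); apply/matrixP=> i j.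
rewrite !mxE nth_map_iota !resultE /= -(inj_eq val_inj).
by case: (_ == _); rewrite ?mxE.
Qed.

Definition enc_set (Rs : {set 'I_k}) : seq bool := [seq b \in Rs | b <- enum 'I_k].

Lemma nth_enc_set (Rs : {set 'I_k}) (a : 'I_k) : nth false (enc_set Rs) a = (a \in Rs).
Proof. by rewrite (nth_map a) ?size_enum_ord // nth_ord_enum. Qed.

Lemma result_expand_prog (st : den F StTy) (Rs : {set 'I_k}) : wf_state st ->
  result expand_prog ((enc_set Rs, (st, env)) : den F (Prod (List Bool) (Prod StTy EnvTy)))
  = enc_set (grow_layer n l xvec bnat (state_mx st) (ulabel st) Rs).
Proof.
move=> wf; rewrite /expand_prog unlock !resultE /= iota_ord -map_comp.
apply: eq_map => b /=; rewrite !resultE /= inE -/(ulabel st b); congr (_ || _).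
rewrite has_iota; apply: eq_existsb => s; rewrite !resultE /= has_iota.
apply: eq_existsb => a; rewrite !resultE /= nth_enc_set.
by rewrite result_cand_prog.
Qed.

Lemma result_hit_prog (st : den F StTy) d (a : 'I_k) (s u : nat) : wf_state st ->
  result hit_prog ((val a, (s, (u, (enc_set (layer n l xvec bnat (state_mx st) (ulabel st) d),
      (st, env))))) :
    den F (Prod Nat (Prod Nat (Prod Nat (Prod (List Bool) (Prod StTy EnvTy)))))) =
  hit n l xvec bnat (state_mx st) (ulabel st) d u s a.
Proof.
move=> wf; rewrite /hit_prog unlock !resultE /= nth_enc_set result_cand_prog // /hit.
congr (_ && _); have [_ _ _ szU] := wf; rewrite (all_nth_ord 0%N _ szU).
by apply: eq_forallb => b; rewrite !resultE.
Qed.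

Let hits (st : den F StTy) := hit n l xvec bnat (state_mx st) (ulabel st).
Let some_hit (st : den F StTy) := has_hit n l xvec bnat (state_mx st) (ulabel st).

Lemma head_filter_has (T : Type) (x0 : T) (p : pred T) s :
  has p s -> p (head x0 [seq x <- s | p x]).
Proof. by elim: s => //= x s IHs; case px : (p x). Qed.

(** The head of a nonempty list of exchanges is one from layer [d]; an empty
    list witnesses that there is none. *)
Definition is_hit st d (f : seq (nat * (nat * nat))) : Prop :=
  if f is (u, (s, a)) :: _ then exists2 b : 'I_k, a = b & hits st d u s b
  else ~~ some_hit st d.

Lemma result_search_prog (st : den F StTy) d : wf_state st ->
  is_hit st d (result search_prog
    ((enc_set (layer n l xvec bnat (state_mx st) (ulabel st) d), (st, env)) :
       den F (Prod (List Bool) (Prod StTy EnvTy)))).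
Proof.
move=> wf; rewrite /search_prog unlock !resultE /=.
set Rs := enc_set _.
pose h a s u := result hit_prog ((a, (s, (u, (Rs, (st, env))))) :
  den F (Prod Nat (Prod Nat (Prod Nat (Prod (List Bool) (Prod StTy EnvTy)))))).
have hE (a : 'I_k) s u : h a s u = hits st d u s a by apply: result_hit_prog.
rewrite (_ : [seq y <- iota 0 l | _] = [seq u <- iota 0 l |
    has (fun s => has (fun a => h a s u) (iota 0 k)) (iota 0 n)]); last first.
  apply: eq_filter => u; rewrite !resultE /=; apply: eq_has => s.
  by rewrite !resultE.
set u0 := head 0%N [seq u <- iota 0 l | _].
rewrite (_ : [seq y <- iota 0 n | _] = [seq s <- iota 0 n |
    has (fun a => h a s u0) (iota 0 k)]); last first.
  by apply: eq_filter => s; rewrite !resultE.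
set s0 := head 0%N [seq s <- iota 0 n | _].
rewrite [X in is_hit _ _ X](_ : _ =
    [seq (u0, (s0, a)) | a <- iota 0 k & h a s0 u0]); last first.
  by apply: eq_map => a; rewrite !resultE.
rewrite /is_hit; case Df : [seq _ | _ <- _ & _] => [|[u [s a]] f].
  apply/negP=> /existsP[u /existsP[s /existsP[a H]]].
  have : has (fun u => has (fun s => has (fun a => h a s u) (iota 0 k)) (iota 0 n))
      (iota 0 l).
    rewrite has_iota; apply/existsP; exists u; rewrite has_iota; apply/existsP.
    by exists s; rewrite has_iota; apply/existsP; exists a; rewrite hE.
  move/(head_filter_has 0%N); rewrite -/u0 => /(head_filter_has 0%N).
  rewrite -/s0 has_filter -size_eq0 -(size_map (fun a => (u0, (s0, a)))).
  by rewrite Df.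
have : (u, (s, a)) \in (u, (s, a)) :: f by rewrite mem_head.
rewrite -Df => /mapP[b]; rewrite mem_filter mem_iota add0n /= => /andP[hb ltb].
by case=> -> -> ->; exists (Ordinal ltb); rewrite // -hE.
Qed.

Lemma result_first_exchange_prog (st : den F StTy) : wf_state st ->
  let f := result first_exchange_prog ((st, env) : den F (Prod StTy EnvTy)) in
  match f with
  | [::] => is_true (~~ some_hit st k)
  | _ => is_hit st (first_hit n l xvec bnat (state_mx st) (ulabel st)) f
  end.
Proof.
move=> wf; rewrite /first_exchange_prog unlock !resultE /=.
pose h (acc : seq bool * seq (nat * (nat * nat))) :=
  let R := result expand_prog ((acc.1, (st, env)) :
    den F (Prod (List Bool) (Prod StTy EnvTy))) in
  (R, if acc.2 is [::] then result search_prog ((R, (st, env)) :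
    den F (Prod (List Bool) (Prod StTy EnvTy))) else acc.2).
rewrite (_ : [seq _ | y <- iota 0 k] = enc_set finset.set0); last first.
  rewrite /enc_set iota_ord -map_comp; apply: eq_map => b /=.
  by rewrite !resultE inE.
rewrite (@foldl_iter _ _ _ h); last first.
  move=> [R f] i; rewrite !resultE /h /=; congr (_, _).
  by case: f => // y f; rewrite !resultE.
have inv j : (j <= k)%N ->
  exists f, iter j h (enc_set finset.set0, [::]) =
    (enc_set (layer n l xvec bnat (state_mx st) (ulabel st) j), f) /\
  match f with
  | [::] => forall d, (d <= j)%N -> ~~ some_hit st d
  | _ => exists d, [/\ (d <= j)%N, is_hit st d f
                     & forall e, (e < d)%N -> ~~ some_hit st e]
  end.
  elim: j => [_ | j IHj ltj].
    exists [::]; split=> // d; rewrite leqn0 => /eqP->.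
    by apply/negP=> /existsP[u /existsP[s /existsP[a]]]; rewrite /hit inE andbF.
  have [f [E Hf]] := IHj (ltnW ltj); rewrite iterS E /h /= result_expand_prog //.
  rewrite -[grow_layer _ _ _ _ _ _ _]/(layer n l xvec bnat (state_mx st) (ulabel st) j.+1).
  have Hs := result_search_prog j.+1 wf.
  eexists; split; first by [].
  case: f {E} Hf => [none | y f [d [led Hd before]]]; last first.
    by exists d; split=> //; apply: leqW.
  set g := result search_prog _ in Hs *.
  case Dg : g Hs => [|y g'] Hs.
    by move=> d; rewrite leq_eqVlt => /predU1P[-> // | ]; rewrite ltnS; apply: none.
  by exists j.+1; split=> // e; rewrite ltnS; apply: none.
rewrite size_iota; have [f [-> Hf]] := inv k (leqnn k) => /=.
case: f Hf => [none | [u [s a]] f [d [led Hd before]]]; first exact: none.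
have [b _ Hb] := Hd; rewrite /= (first_hit_eq (d := d)) //.
apply/has_hitP; first exact: bnat_range.
by exists u, s, b.
Qed.

Lemma result_step_prog (st : den F StTy) : wf_state st ->
  let st' := result step_prog ((st, env) : den F (Prod StTy EnvTy)) in
  wf_state st' /\
  (st' = st /\ ~~ some_hit st k \/
    exists u s a, [/\ hits st (first_hit n l xvec bnat (state_mx st) (ulabel st)) u s a,
      state_mx st' = set_row (state_mx st) a (xvec s), ulabel st' = upd (ulabel st) a u
      & slabel st' = upd (slabel st) a s]).
Proof.
move=> wf; rewrite /step_prog unlock result_elcase /=.
have := result_first_exchange_prog wf => /=.
set f := result first_exchange_prog _; case: f => [|[u [s a']] f].
  by rewrite !resultE; split=> //; left.
case=> a -> H; have bsu : bnat s u by case/and3P: H => _ _ /andP[].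
have [lts ltu] := bnat_range bsu; have [szV szVk szS szU] := wf.
rewrite !resultE /=; split.
  split; rewrite /= ?size_map ?size_iota //.
  rewrite all_map; apply/allP=> c; rewrite mem_iota add0n /= => ltc.
  rewrite !resultE /=; case: ifP => _; first by rewrite size_nth_enc_mx.
  by apply: (allP szVk); rewrite mem_nth ?szV.
right; exists u, s, a; split=> //.
- apply/matrixP=> i j; rewrite !mxE /= nth_map_iota !resultE /= -(inj_eq val_inj).
  by case: (_ == _); rewrite ?mxE.
- apply/funext=> b; rewrite /ulabel /upd /= nth_map_iota !resultE /=.
  by rewrite -(inj_eq val_inj); case: (_ == _).
- apply/funext=> b; rewrite /slabel /upd /= nth_map_iota !resultE /=.
  by rewrite -(inj_eq val_inj); case: (_ == _).
Qed.

Let inv (st : den F StTy) : Prop :=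
  wf_state st /\ exch_inv l xvec bnat (state_mx st) (ulabel st) (slabel st).
Let measure (st : den F StTy) : nat :=
  exch_measure n l xvec bnat (state_mx st) (ulabel st).
Let dummy_count (st : den F StTy) : nat := dummies l (ulabel st).

Lemma result_init_prog :
  let st := result init_prog env in inv st.
Proof.
rewrite /init_prog unlock !resultE /=; set st := (_, _).
have wf : wf_state st.
  split; rewrite /= ?size_map ?size_iota //.
  by rewrite all_map; apply/allP=> b _ /=; rewrite resultE size_map !resultE size_iota.
have Ul b : ulabel st b = l by rewrite /ulabel /= nth_map_iota !resultE.
split=> //; split=> [|b|a b]; rewrite ?Ul ?eqxx //.
suff -> : state_mx st = 1%:M by exact: unitmx1.
apply/matrixP=> i j; rewrite !mxE /= nth_map_iota !resultE /= nth_map_iota !resultE /=.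
by rewrite eq_sym -(inj_eq val_inj); case: (_ == _).
Qed.

Let next (st : den F StTy) : den F StTy :=
  result step_prog ((st, env) : den F (Prod StTy EnvTy)).

Hypothesis solvable : exists s u, solution xvec bnat s u.

Lemma next_inv st : inv st ->
  [/\ inv (next st), (dummy_count (next st) <= dummy_count st)%N
    & (0 < dummy_count st)%N -> (measure (next st) < measure st)%N].
Proof.
case=> wf ex; have [wf' [[same nohit] | [u [s [a [H EG EU ES]]]]]] :=
  result_step_prog wf.
  rewrite /next same; split=> //; rewrite lt0n => /negP[]; rewrite cards_eq0.
  have [s [u sol]] := solvable.
  have nd := no_hit_no_dummy bnat_range ex sol nohit.
  by apply/eqP/setP=> b; rewrite !inE (negPf (nd b)).
have [ex' lt] := exchange bnat_range ex H.
split; last by move=> _; rewrite /measure EG EU.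
  by split=> //; rewrite /next EG EU ES.
by rewrite /dummy_count /next EU; apply: dummies_exchange H; apply: bnat_range.
Qed.

Lemma iter_next N st : inv st -> inv (iter N next st).
Proof. by move=> ist; elim: N => //= N /next_inv[]. Qed.

(** Once no artificial vector is left, later steps do not bring one back. *)
Lemma iter_next_dummies N st : inv st -> (measure st < N)%N ->
  dummy_count (iter N next st) = 0%N.
Proof.
elim: N st => // N IHN st ist; rewrite ltnS iterSr => leN.
have [ist' _ lt] := next_inv ist.
have [d0 | d_gt0] := posnP (dummy_count st); last first.
  by apply: IHN => //; apply: leq_trans (lt d_gt0) leN.
have : dummy_count (next st) = 0%N.
  by apply/eqP; have [_ + _] := next_inv ist; rewrite d0 leqn0.
elim: N (next st) ist' {IHN leN lt ist d0} => // N IHN st' ist' d0.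
rewrite iterSr; have [ist'' le _] := next_inv ist'; apply: IHN => //.
by apply/eqP; rewrite -leqn0 -d0.
Qed.

Lemma iter_iter (T : Type) (f : T -> T) a b x :
  iter a (iter b f) x = iter (a * b) f x.
Proof. by elim: a => //= a ->; rewrite mulSn iterD. Qed.

Lemma result_basis_prog :
  let st := result basis_prog env in inv st /\ forall b, ulabel st b != l.
Proof.
have -> : result basis_prog env = iter (k.+2 * k.+2) next (result init_prog env).
  rewrite -iter_iter /basis_prog unlock !resultE size_iota.
  apply: eq_iter => st; rewrite !resultE; apply: eq_iter => st'.
  by rewrite !resultE.
have ist := result_init_prog; split; first exact: iter_next.
apply: dummies_eq0; apply: iter_next_dummies => //.
apply: (@leq_ltn_trans (k * k.+2 + k.+1)%N); last by lia.
apply: leq_add; last exact: first_hit_max.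
by rewrite leq_mul2r /dummies (leq_trans (max_card _)) ?orbT ?card_ord.
Qed.

End Step1Spec.

Section SortOrd.

Variables (n k : nat) (g : 'I_k -> 'I_n).
Hypothesis injg : injective g.

Definition sorted_codom : seq 'I_n := [seq s <- enum 'I_n | s \in codom g].

(** The increasing enumeration of the values of [g]; the default value is never
    reached. *)
Definition sort_ord (a : 'I_k) : 'I_n := nth (g a) sorted_codom a.

Lemma mem_sorted_codom s : (s \in sorted_codom) = (s \in codom g).
Proof. by rewrite mem_filter mem_enum andbT. Qed.

Lemma size_sorted_codom : size sorted_codom = k.
Proof.
have /perm_size -> : perm_eq sorted_codom (codom g).
  apply: uniq_perm; last exact: mem_sorted_codom.
    by rewrite filter_uniq ?enum_uniq.
  by rewrite map_inj_uniq ?enum_uniq.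
by rewrite size_codom card_ord.
Qed.

Lemma sort_ord_nth s0 a : sort_ord a = nth s0 sorted_codom a.
Proof. by apply: set_nth_default; rewrite size_sorted_codom. Qed.

Lemma map_sort_ord : [seq sort_ord a | a <- enum 'I_k] = sorted_codom.
Proof.
have [k0 | k_gt0] := posnP k.
  have -> : sorted_codom = [::] by apply: size0nil; rewrite size_sorted_codom.
  by apply: size0nil; rewrite size_map size_enum_ord.
pose a0 : 'I_k := Ordinal k_gt0; apply: (@eq_from_nth _ (g a0)).
  by rewrite size_map size_enum_ord size_sorted_codom.
move=> j; rewrite size_map size_enum_ord => ltj.
rewrite (nth_map a0) ?size_enum_ord // (sort_ord_nth (g a0)).
by rewrite nth_enum_ord.
Qed.

Lemma sort_ord_homo : {homo sort_ord : a b / (a < b)%N}.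
Proof.
move=> a b ltab; rewrite !(sort_ord_nth (g a)).
have srt : sorted ltn [seq val s | s <- sorted_codom].
  apply: (subseq_sorted ltn_trans (s2 := iota 0 n)); last exact: iota_ltn_sorted.
  by rewrite iota_ord; apply: map_subseq; apply: filter_subseq.
have szb := size_sorted_codom.
rewrite -!(nth_map (g a) 0%N val) ?szb //.
by rewrite (sorted_ltn_nth ltn_trans) // inE size_map szb.
Qed.

Lemma sort_ordP a : exists b, sort_ord a = g b.
Proof.
have : sort_ord a \in sorted_codom by rewrite mem_nth ?size_sorted_codom.
by rewrite mem_sorted_codom => /codomP[b]; exists b.
Qed.

Lemma mem_sort_ord b : g b \in codom sort_ord.
Proof.
have : g b \in sorted_codom by rewrite mem_sorted_codom codom_f.
by rewrite -map_sort_ord => /mapP[a _ ->]; apply: codom_f.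
Qed.

Lemma sort_ord_inj : injective sort_ord.
Proof.
move=> a b eqab; case: (ltngtP a b) => [lt | lt | /val_inj //].
  by have := sort_ord_homo lt; rewrite eqab ltnn.
by have := sort_ord_homo lt; rewrite eqab ltnn.
Qed.

Lemma imset_sort_ord : [set sort_ord a | a : 'I_k] = [set g a | a : 'I_k].
Proof.
apply/setP=> s; apply/imsetP/imsetP=> [[a _ ->] | [b _ ->]].
  by have [b ->] := sort_ordP a; exists b.
by have /codomP[a ->] := mem_sort_ord b; exists a.
Qed.

End SortOrd.

(** The free entries at the positions [(g a, h a)] form a permutation matrix in
    the submatrix of the rows [g] and the columns [h]. *)
Lemma generic_rank_matching (R : realType) (n l k : nat) (Bb : 'M[bool]_(n, l))
    (g : 'I_k -> 'I_n) (h : 'I_k -> 'I_l) :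
  injective g -> injective h -> (forall a, Bb (g a) (h a)) ->
  generic_rank R (mxsub (sort_ord g) (sort_ord h) Bb) k.
Proof.
move=> injg injh Bgh; split=> [|P _]; last exact: rank_leq_row.
have /fin_all_exists[al Hal] a : exists b, sort_ord g a = g b by apply: sort_ordP.
have /fin_all_exists[be Hbe] a : exists b, sort_ord h a = h b by apply: sort_ordP.
have injal : injective al.
  by move=> a b E; apply: (sort_ord_inj injg); rewrite !Hal E.
have injbe : injective be.
  by move=> a b E; apply: (sort_ord_inj injh); rewrite !Hbe E.
pose P : 'M[R]_k := \matrix_(a, b) (al a == be b)%:R; exists P; split.
  move=> a b; rewrite !mxE Hal Hbe; case: eqP => // ->.
  by rewrite Bgh.
apply/eqP; rewrite -[_ == _]/(row_free P); apply/row_free_kerP=> v vP.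
have [be' beK be'K] := injF_bij injbe.
apply/rowP=> a; have /rowP/(_ (be' (al a))) := vP; rewrite !mxE => <-.
rewrite (bigD1 a) //= mxE be'K eqxx mulr1 big1 ?addr0 // => c neq.
by rewrite mxE be'K (inj_eq injal) (negPf neq) mulr0.
Qed.

Section FinalState.

Variables (F : fieldType) (n l k : nat) (X : 'M[F]_(n, k)) (Bb : 'M[bool]_(n, l)).
Hypothesis solvable : exists s u, solution (xvec X) (bnat Bb) s u.

Lemma result_output_prog (st : den F StTy) (g : 'I_k -> 'I_n) (h : 'I_k -> 'I_l) :
  wf_state k st -> injective g -> injective h ->
  (forall b, val (g b) = slabel st b) -> (forall b, val (h b) = ulabel st b) ->
  result output_prog ((st, env X Bb) : den F (Prod StTy EnvTy)) =
  enc_choice (Defs.Choice (sort_ord g) (sort_ord h) (fun j => (g j, h j))).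
Proof.
case: st => V [Sl Ul] [/= _ _ szS szU] injg injh Hg Hh.
rewrite /output_prog unlock !resultE /= /enc_choice /=.
have mem_lab m (L : seq nat) (f : 'I_k -> 'I_m) : size L = k ->
    (forall b, val (f b) = nth 0%N L b) ->
    forall s : 'I_m, has (fun x => x == val s) L = (s \in codom f).
  move=> szL Hf s; apply/hasP/codomP=> [[x /(nthP 0%N)[j ltj <-] /eqP E] | [b ->]].
    rewrite szL in ltj; exists (Ordinal ltj); apply: val_inj.
    by rewrite -E Hf.
  by exists (val (f b)) => //; rewrite Hf mem_nth ?szL.
have sorted_lab m (L : seq nat) (f : 'I_k -> 'I_m) (p : nat -> bool) :
    injective f -> size L = k -> (forall b, val (f b) = nth 0%N L b) ->
    (forall s, p s = has (fun x => x == s) L) ->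
    [seq s <- iota 0 m | p s] = [seq val (sort_ord f a) | a <- enum 'I_k].
  move=> injf szL Hf Hp; rewrite [RHS](map_comp val (sort_ord f)).
  rewrite map_sort_ord // iota_ord filter_map.
  by congr map; apply: eq_filter => s /=; rewrite Hp (mem_lab _ _ f).
congr (_, _, _).
- apply: (sorted_lab _ Sl g) => // s; rewrite !resultE /=.
  by apply: eq_has => x; rewrite !resultE.
- apply: (sorted_lab _ Ul h) => // s; rewrite !resultE /=.
  by apply: eq_has => x; rewrite !resultE.
rewrite iota_ord -map_comp; apply: eq_map => b /=; rewrite !resultE /=.
by rewrite Hg Hh.
Qed.

Lemma final_state : exists (S : Defs.choice n l k) (g : 'I_k -> 'I_n) (h : 'I_k -> 'I_l),
  [/\ injective g /\ injective h, forall b, Bb (g b) (h b), row_free (colsub g X^T),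
      S = Defs.Choice (sort_ord g) (sort_ord h) (fun j => (g j, h j))
    & result (elet basis_prog output_prog) (env X Bb) = enc_choice S].
Proof.
have [[wf [Gu labels injU]] nd] := result_basis_prog solvable.
set st := result basis_prog _ in wf Gu labels injU nd.
have range b := bnat_range (labels b (nd b)).1.
pose g b : 'I_n := Ordinal (range b).1; pose h b : 'I_l := Ordinal (range b).2.
have Bgh b : Bb (g b) (h b).
  by have [] := labels b (nd b); rewrite /bnat -(nth_enc_mx false Bb).
have injh : injective h by move=> a b /(congr1 val) /= E; apply: injU E (nd a).
have rowX b : row b (state_mx k st) = row (g b) X.
  rewrite (labels b (nd b)).2; apply/rowP=> j; rewrite !mxE.
  exact: (nth_enc_mx 0 X (g b)).
have free : row_free (colsub g X^T).
  have -> : colsub g X^T = (state_mx k st)^T.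
    apply/matrixP=> i j; rewrite [RHS]mxE.
    by have /rowP/(_ i) := rowX j; rewrite !mxE.
  by rewrite row_free_unit unitmx_tr.
have injg : injective g.
  move=> a b E; apply/eqP; apply: contraT => neq.
  have := Gu; rewrite -row_free_unit => /row_free_kerP/(_ (delta_mx 0 a - delta_mx 0 b)).
  rewrite mulmxBl -!rowE !rowX E subrr => /(_ erefl) /rowP/(_ a).
  by rewrite !mxE !eqxx (negPf neq) subr0 => /eqP; rewrite oner_eq0.
exists (Defs.Choice (sort_ord g) (sort_ord h) (fun j => (g j, h j))), g, h.
split=> //; rewrite result_elet; exact: result_output_prog.
Qed.

End FinalState.

Section Step1Correct.

Variables (R : realType) (n l p : nat) (A : 'M[R]_n) (lam : 'I_p -> R[i]).
Local Notation k i := (geom_mult A (lam i)).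
Variables (X : forall i, 'M[R[i]]_(n, k i)) (Bbar : 'M[bool]_(n, l)).
Hypothesis n_gt0 : (0 < n)%N.

(** The paths select distinct columns and, since their rows form a set of
    [Hset], independent rows of [X i]. *)
Lemma matching_solution (i : 'I_p) : independent_matching X Bbar ->
  exists s u, solution (xvec (X i)) (bnat Bbar) s u.
Proof.
case/(_ i) => u [s [r [pathP disjP HJ]]].
have injs : injective s.
  have : #|[set s a | a : 'I_(k i)]| == #|'I_(k i)|.
    by move: HJ; rewrite inE card_ord => /andP[].
  by move/imset_injP=> injs a b; apply: injs.
rewrite mem_Hset // in HJ.
exists (fun a => val (s a)), (fun a => val (u a)); split.
- move=> a; rewrite /bnat nth_enc_mx.
  by have /= /andP[] := pathP a.
- move=> a b /val_inj uab; apply/eqP; apply: contraT => /disjP/disjointFr.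
  move/(_ (input_vertex A lam (u a))); rewrite !inE eqxx /= => /(_ isT).
  by rewrite uab eqxx.
suff -> : (\matrix_(j, c) xvec (X i) (val (s j)) 0 c) = (colsub s (X i)^T)^T.
  by rewrite unitmx_tr -row_free_unit.
by apply/matrixP=> a b; rewrite !mxE nth_enc_mx.
Qed.

Lemma result_env_prog (F : fieldType) m (Y : 'M[F]_(n, m)) :
  result env_prog ((enc_mx Y, enc_mx Bbar) : den F (Prod (Mat Scal) (Mat Bool))) =
  env Y Bbar.
Proof.
rewrite /env_prog unlock !resultE /env size_enc_mx.
have hd0 T q (M : 'M[T]_(n, q)) : size (head [::] (enc_mx M)) = q.
  by rewrite -nth0 size_nth_enc_mx.
by rewrite !hd0.
Qed.

Lemma result_step1_prog : independent_matching X Bbar ->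
  exists S : choices l A lam, step1_valid X Bbar S /\
    result step1_prog (enc_input X Bbar) = enc_choices S.
Proof.
move=> matchB.
have /fin_all_exists[S HS] i := final_state (matching_solution i matchB).
exists S; split.
  move=> i; have [g [h [[injg injh] Bgh freeX DS _]]] := HS i.
  rewrite /valid_choice DS /=; split.
  - exact: sort_ord_homo.
  - exact: sort_ord_homo.
  - exact: generic_rank_matching.
  - by rewrite imset_sort_ord // mem_Hset.
  split=> // j; split=> //; exact: mem_sort_ord.
rewrite /step1_prog unlock !resultE /enc_choices /= -map_comp; apply: eq_map => i /=.
rewrite !resultE /mode_prog unlock !resultE /= result_env_prog.
by have [g [h [_ _ _ _]]] := HS i; rewrite result_elet.
Qed.

End Step1Correct.

(** * The program that chooses the multipliers *)

Notation w6 := (sh w5).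
Notation w7 := (sh w6).
Notation w8 := (sh w7).

(** In the context [(X, (cols, B))].  The rows of the tested matrix are the
    columns of the one that defines [mode_det]. *)
Definition mode_det_prog : prog (Prod (Mat Scal) (Prod (List Nat) (Mat Scal))) Bool :=
  locked_with (prog_key 114)
  (ecall independent_prog
    (emap v1 (emap (eidx (ehd (PNil _ _) v1))
      (efold (eidx v2) (PS0 _)
        (* in the context (s, (acc, (a, (c, (X, (cols, B)))))) *)
        (eadd v1 (emul (enth (PS0 _) (enth (PNil _ _) v4 v0) v2)
                       (enth (PS0 _) (enth (PNil _ _) w6 v0) v3))))))).

Definition no_choice {G : ty} :
    prog G (Prod (Prod (List Nat) (List Nat)) (List (Prod Nat Nat))) :=
  epair (epair (PNil _ _) (PNil _ _)) (PNil _ _).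

(** In the context [(B, (input, choices))]. *)
Definition zset_prog : prog (Prod (Mat Scal) (Prod InputTy ChoicesTy)) (List Nat) :=
  locked_with (prog_key 115)
  (efilter (eidx (efst (esnd v1)))
    (ecall mode_det_prog
      (epair (enth (PNil _ _) (efst (esnd v2)) v0)
        (epair (esnd (efst (enth no_choice w3 v0))) v1)))).

(** In the context [(m, (par, B))]. *)
Definition update_prog : prog (Prod Scal (Prod (List (Prod Nat Nat)) (Mat Scal)))
    (Mat Scal) :=
  locked_with (prog_key 116)
  (emap (eidx w2) (emap (eidx (ehd (PNil _ _) w3))
    (efold v3 (enth (PS0 _) (enth (PNil _ _) w4 v1) v0)
      (* in the context (x, (acc, (c, (r, (m, (par, B)))))) *)
      (eif (eand (eeqn (efst v0) v3) (eeqn (esnd v0) v2)) (eadd v1 v4) v1)))).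

(** In the context [(c, (acc, (ch, (_, (par, (q, (B, (input, choices))))))))], where
    [acc] is the pair of the current and of the best multiplier.  The column
    indices [c] of all the choices [ch] serve as a counter: they are as many as
    the multipliers to be tried, except the first one. *)
Definition next_multiplier_prog :
    prog (Prod Nat (Prod (Prod Scal Scal)
      (Prod (Prod (Prod (List Nat) (List Nat)) (List (Prod Nat Nat)))
        (Prod (Prod Scal Scal) (Prod (List (Prod Nat Nat))
          (Prod Nat (Prod (Mat Scal) (Prod InputTy ChoicesTy))))))))
      (Prod Scal Scal) :=
  locked_with (prog_key 117)
  (elet (eadd (efst v1) (PS1 _))
    (epair v0
      (eif (elesize
             (ecall zset_prog (epair (ecall update_prog (epair v0 (epair v5 v7))) w8))
             (ecall zset_prog
               (epair (ecall update_prog (epair (esnd v2) (epair v5 v7))) w8)))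
        v0 (esnd v2)))).

(** In the context [(q, (B, (input, choices)))]. *)
Definition visit_prog :
    prog (Prod Nat (Prod (Mat Scal) (Prod InputTy ChoicesTy))) (Mat Scal) :=
  locked_with (prog_key 118)
  (eif (ecall mode_det_prog
         (epair (enth (PNil _ _) (efst (esnd v2)) v0)
           (epair (esnd (efst (enth no_choice w3 v0))) v1)))
    v1
    (elet (esnd (enth no_choice w3 v0))
      (elet
        (esnd (efold w4 (epair (PS1 _) (PS1 _))
                (efold (esnd (efst v0)) v1 next_multiplier_prog)))
        (ecall update_prog (epair v0 (epair v1 v3)))))).

(** In the context [(input, choices)].  All the modes are visited: stopping early
    would return the same matrix. *)
Definition steps23_prog : prog (Prod InputTy ChoicesTy) (Mat Scal) :=
  locked_with (prog_key 119)
  (efold (eidx (efst (esnd v0))) (emap (esnd (esnd v0)) (emap v0 (PS0 _)))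
    visit_prog).

Section Steps23Cost.

Variable F : fieldType.

Lemma good_mode_det_prog : good F mode_det_prog.
Proof. by rewrite /mode_det_prog unlock; have ? := good_independent_prog F; good_prog. Qed.

Lemma good_zset_prog : good F zset_prog.
Proof.
by rewrite /zset_prog unlock /no_choice; have ? := good_mode_det_prog; good_prog.
Qed.

Lemma good_update_prog : good F update_prog.
Proof. by rewrite /update_prog unlock; good_prog. Qed.

Lemma good_next_multiplier_prog : good F next_multiplier_prog.
Proof.
rewrite /next_multiplier_prog unlock.
by have ? := good_zset_prog; have ? := good_update_prog; good_prog.
Qed.

Lemma good_visit_prog : good F visit_prog.
Proof.
rewrite /visit_prog unlock /no_choice; have ? := good_mode_det_prog.
by have ? := good_next_multiplier_prog; have ? := good_update_prog; good_prog.
Qed.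

Lemma good_steps23_prog : good F steps23_prog.
Proof. by rewrite /steps23_prog unlock; have ? := good_visit_prog; good_prog. Qed.

End Steps23Cost.

Lemma foldl_add (V : zmodType) (T : Type) (f : T -> V) (s : seq T) (z : V) :
  foldl (fun acc x => acc + f x) z s = z + \sum_(x <- s) f x.
Proof.
elim: s z => [|x s IHs] z /=; first by rewrite big_nil addr0.
by rewrite IHs big_cons addrA.
Qed.

Lemma big_iota_ord (V : zmodType) (m : nat) (f : nat -> V) :
  \sum_(s <- iota 0 m) f s = \sum_(s < m) f s.
Proof. by rewrite iota_ord big_map big_enum. Qed.

Lemma eq_foldl (T U : Type) (f g : T -> U -> T) (s : seq U) z :
  (forall x y, f x y = g x y) -> foldl f z s = foldl g z s.
Proof. by move=> fg; elim: s z => //= y s IHs z; rewrite IHs fg. Qed.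

Lemma iter_argmax (z : nat -> nat) N :
  let acc := iter N (fun acc : nat * nat =>
    (acc.1.+1, if (z acc.2 <= z acc.1.+1)%N then acc.1.+1 else acc.2)) (1, 1)%N in
  [/\ acc.1 = N.+1, (1 <= acc.2 <= 1 + N)%N
    & forall m, (1 <= m <= 1 + N)%N -> (z m <= z acc.2)%N].
Proof.
elim: N => [|N [IH1 IH2 IH]] /=.
  by split=> // m; rewrite addn0 -eqn_leq => /eqP <-.
rewrite IH1; split=> //.
  case: ifP => _ /=; first by rewrite add1n.
  by case/andP: IH2 => -> /= /leq_trans -> //; rewrite leq_add2l.
move=> m; rewrite addnS [X in _ && X]leq_eqVlt; case/andP=> m_gt0 /predU1P[-> | ltm].
  rewrite add1n; case: ifP => /= [_ // | /negbT]; rewrite -ltnNge.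
  exact: ltnW.
have le := IH m; rewrite m_gt0 -ltnS ltm in le; have {}le := le isT.
case: ifP => /= [/(leq_trans le) // | _]; exact: le.
Qed.

Section Steps23Spec.

Variables (R : realType) (n l p : nat) (A : 'M[R]_n) (lam : 'I_p -> R[i]).
Local Notation k i := (geom_mult A (lam i)).
Variables (X : forall i, 'M[R[i]]_(n, k i)) (Bbar : 'M[bool]_(n, l)).
Hypothesis n_gt0 : (0 < n)%N.
Variable S : choices l A lam.

Local Notation input := (enc_input X Bbar).
Local Notation chosen := (enc_choices S).

Lemma size_head_enc_mx T m (M : 'M[T]_(n, m)) : size (head [::] (enc_mx M)) = m.
Proof. by rewrite -nth0 size_nth_enc_mx. Qed.

Lemma nth_modes x0 (i : 'I_p) :
  nth x0 [seq enc_mx (X q) | q <- enum 'I_p] i = enc_mx (X i).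
Proof. by rewrite (nth_map i) ?size_enum_ord // nth_ord_enum. Qed.

Lemma nth_choices x0 (i : 'I_p) : nth x0 (chosen : seq _) i = enc_choice (S i).
Proof. by rewrite (nth_map i) ?size_enum_ord // nth_ord_enum. Qed.

Lemma result_mode_det_prog (i : 'I_p) (B : 'M[R]_(n, l)) :
  result mode_det_prog
    ((enc_mx (X i), ((enc_choice (S i)).1.2, enc_output B)) :
       den R[i] (Prod (Mat Scal) (Prod (List Nat) (Mat Scal)))) =
  (mode_det X S i B != 0).
Proof.
rewrite /mode_det_prog unlock !resultE result_independent_prog /=.
set rows := map _ _; have szr : size rows = k i.
  by rewrite size_map size_map size_enum_ord.
have szc : all (fun v : seq R[i] => size v == k i) rows.
  rewrite all_map; apply/allP=> c _ /=.
  by rewrite !resultE /= size_map size_iota size_head_enc_mx.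
rewrite (independentE szr szc) /rows.
rewrite row_free_unit -unitmx_tr unitmxE unitfE /mode_det; congr (\det _ != 0).
apply/matrixP=> a b; rewrite !mxE -map_comp (nth_map b) ?size_enum_ord //.
rewrite nth_ord_enum /= !resultE /= size_head_enc_mx nth_map_iota !resultE /=.
rewrite (@eq_foldl _ _ _ (fun acc s => acc + nth 0 (nth [::] (enc_mx (X i)) s) a *
    nth 0 (nth [::] (enc_output B) s) (cols (S i) b))); last first.
  by move=> acc s; rewrite !resultE.
rewrite foldl_add add0r size_enc_mx big_iota_ord.
by apply: eq_bigr => s _; rewrite nth_enc_mx nth_enc_mx !mxE.
Qed.

Lemma result_zset_prog (B : 'M[R]_(n, l)) :
  size (result zset_prog ((enc_output B, (input, chosen)) :
    den R[i] (Prod (Mat Scal) (Prod InputTy ChoicesTy))) : seq nat) =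
  #|Zset X S B|.
Proof.
rewrite /zset_prog unlock !resultE /= size_map size_enum_ord.
rewrite iota_ord filter_map size_map size_filter -sum1_count -sum1_card.
rewrite big_enum_cond /=; apply: eq_bigl => q; rewrite !resultE /= nth_modes.
by rewrite nth_choices result_mode_det_prog inE.
Qed.

Lemma result_update_prog (i : 'I_p) (B : 'M[R]_(n, l)) (m : nat) :
  result update_prog ((m%:R, ((enc_choice (S i)).2, enc_output B)) :
    den R[i] (Prod Scal (Prod (List (Prod Nat Nat)) (Mat Scal)))) =
  enc_output (update S i B m).
Proof.
rewrite /update_prog unlock !resultE /= size_enc_mx /enc_output /enc_mx.
rewrite iota_ord -map_comp; apply: eq_map => r /=; rewrite !resultE /=.
rewrite size_head_enc_mx iota_ord -map_comp; apply: eq_map => c /=; rewrite !resultE /=.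
rewrite (@eq_foldl _ _ _ (fun acc (x : nat * nat) => acc +
    (if (x.1 == r) && (x.2 == c) then m%:R else 0))); last first.
  by move=> acc x; rewrite !resultE /=; case: ifP; rewrite ?addr0.
rewrite foldl_add nth_enc_mx big_map !mxE rmorphD summxE rmorph_sum /=.
congr (_ + _); rewrite big_enum /=; apply: eq_bigr => j _.
rewrite !mxE rmorphM rmorph_nat !(inj_eq val_inj) [r == _]eq_sym [c == _]eq_sym.
by case: (_ && _); rewrite ?rmorph1 ?rmorph0 ?mulr1 ?mulr0.
Qed.

Definition next_multiplier (i : 'I_p) (B : 'M[R]_(n, l)) (acc : nat * nat) :=
  (acc.1.+1,
   if (#|Zset X S (update S i B acc.2)| <= #|Zset X S (update S i B acc.1.+1)|)%N
   then acc.1.+1 else acc.2).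

(** The multiplier that the program selects: a tie replaces the best one. *)
Definition last_argmax (i : 'I_p) (B : 'M[R]_(n, l)) : nat :=
  (iter (\sum_q k q) (next_multiplier i B) (1%N, 1%N)).2.

Lemma last_argmaxP : argmax_rule X S last_argmax.
Proof.
move=> i B.
have [_ range max] := iter_argmax (fun m => #|Zset X S (update S i B m)|) (\sum_q k q).
by split; [exact: range | exact: max].
Qed.

Definition multipliers (acc : nat * nat) : R[i] * R[i] := (acc.1%:R, acc.2%:R).

Lemma result_next_multiplier_prog (i : 'I_p) (B : 'M[R]_(n, l)) c acc ch w q :
  result next_multiplier_prog
    ((c, (multipliers acc, (ch, (w, ((enc_choice (S i)).2,
       (q, (enc_output B, (input, chosen)))))))) :
     den R[i] (Prod Nat (Prod (Prod Scal Scal)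
      (Prod (Prod (Prod (List Nat) (List Nat)) (List (Prod Nat Nat)))
        (Prod (Prod Scal Scal) (Prod (List (Prod Nat Nat))
          (Prod Nat (Prod (Mat Scal) (Prod InputTy ChoicesTy))))))))) =
  multipliers (next_multiplier i B acc).
Proof.
rewrite /next_multiplier_prog unlock !resultE /=.
have -> : acc.1%:R + 1 = acc.1.+1%:R :> R[i] by rewrite -addn1 natrD.
rewrite !result_update_prog !result_zset_prog /multipliers /next_multiplier /=.
by case: ifP.
Qed.

Lemma result_visit_prog (i : 'I_p) (B : 'M[R]_(n, l)) :
  result visit_prog ((val i, (enc_output B, (input, chosen))) :
    den R[i] (Prod Nat (Prod (Mat Scal) (Prod InputTy ChoicesTy)))) =
  enc_output (visit X S last_argmax B i).
Proof.
rewrite /visit_prog unlock !resultE /= nth_modes nth_choices result_mode_det_prog.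
rewrite /visit; case: ifPn => [/negPf-> // | /negPn-> ].
set best := (foldl _ _ _).2; suff -> : best = (last_argmax i B)%:R.
  exact: result_update_prog.
rewrite /best /last_argmax -[RHS]/(multipliers _).2.
rewrite -[(1, 1)]/(multipliers (1%N, 1%N)); congr (_.2).
set f := fun acc y => _.
have fE (q : 'I_p) acc : f (multipliers acc) (enc_choice (S q)) =
    multipliers (iter (k q) (next_multiplier i B) acc).
  rewrite /f !resultE /=; move: {1}(multipliers acc) => w.
  have sz : size [seq val (cols (S q) a) | a <- enum 'I_(k q)] = k q.
    by rewrite size_map size_enum_ord.
  rewrite -[X in iter X]sz.
  elim: [seq val (cols (S q) a) | a <- enum 'I_(k q)] acc => //= c s IHs acc.
  by rewrite -iterS iterSr -IHs result_next_multiplier_prog.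
have -> : (\sum_q k q)%N = (\sum_(q <- enum 'I_p) k q)%N by rewrite big_enum.
rewrite /enc_choices; elim: (enum 'I_p) (1%N, 1%N) => [|q s IHs] acc.
  by rewrite big_nil.
by rewrite big_cons addnC iterD /= fE IHs.
Qed.

Lemma result_steps23_prog :
  result steps23_prog ((input, chosen) : den R[i] (Prod InputTy ChoicesTy)) =
  enc_output (foldl (visit X S last_argmax) 0 (enum 'I_p)).
Proof.
rewrite /steps23_prog unlock !resultE /= size_map size_enum_ord.
set z := map _ _; have -> : z = enc_output (0 : 'M[R]_(n, l)).
  rewrite /z /enc_output /enc_mx -map_comp; apply: eq_map => r /=.
  rewrite !resultE -map_comp; apply: eq_map => c /=.
  by rewrite !resultE !mxE rmorph0.
rewrite iota_ord {z}; elim: (enum 'I_p) (0 : 'M[R]_(n, l)) => //= i s IHs B.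
by rewrite result_visit_prog IHs.
Qed.

End Steps23Spec.

(** * Controllability in polynomial time *)

Lemma bnd_enc_mx (F : fieldType) (a : ty) M m n (Y : 'M[den F a]_(m, n)) :
  (m <= M)%N -> (n <= M)%N -> (forall i j, bnd M (Y i j)) ->
  @bnd F (Mat a) M (enc_mx Y).
Proof.
move=> lem len bY; rewrite /Mat bnd_list size_map size_enum_ord lem all_map /=.
apply/allP=> i _ /=; rewrite size_map size_enum_ord len all_map /=.
by apply/allP=> j _ /=; apply: bY.
Qed.

Section InputSize.

Variables (R : realType) (n l p : nat) (A : 'M[R]_n) (lam : 'I_p -> R[i]).
Local Notation k i := (geom_mult A (lam i)).
Variables (X : forall i, 'M[R[i]]_(n, k i)) (Bbar : 'M[bool]_(n, l)).
Hypothesis eigX : left_eigenbases X.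

Lemma bnd_enc_input : bnd (n + l) (enc_input X Bbar).
Proof.
have lep := leq_trans (num_eigenvalues_le eigX) (leq_addr l n).
have len := leq_addr l n; have lel := leq_addl n l.
rewrite /enc_input !bnd_pair; apply/and3P; split.
- exact: (@bnd_enc_mx _ Scal).
- rewrite bnd_list size_map size_enum_ord lep all_map; apply/allP=> i _.
  apply: (@bnd_enc_mx _ Scal) => //; apply: leq_trans len.
  exact: leq_subr.
- exact: (@bnd_enc_mx _ Bool).
Qed.

Lemma bnd_enc_choices (S : choices l A lam) : bnd (n + l) (enc_choices S).
Proof.
have lep := leq_trans (num_eigenvalues_le eigX) (leq_addr l n).
rewrite /ChoicesTy /enc_choices bnd_list size_map size_enum_ord lep all_map; apply/allP=> i _.
have lek : (k i <= n + l)%N by apply: leq_trans (leq_addr l n); apply: leq_subr.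
have lti (j : 'I_n) : (j <= n + l)%N by rewrite (leq_trans (ltnW (ltn_ord j))) ?leq_addr.
have ltl (j : 'I_l) : (j <= n + l)%N by rewrite (leq_trans (ltnW (ltn_ord j))) ?leq_addl.
have sz (T : Type) (h : 'I_(k i) -> T) : size [seq h a | a <- enum 'I_(k i)] = k i.
  by rewrite size_map size_enum_ord.
rewrite /enc_choice /= !sz lek !all_map /=.
rewrite -andbA; apply/and3P; split.
- by apply/allP=> j _ /=.
- by apply/allP=> j _ /=.
by apply/allP=> j _ /=; rewrite lti ltl.
Qed.

End InputSize.

Theorem theorem2 (R : realType) :
  exists (prog1 : prog InputTy ChoicesTy)
         (prog23 : prog (Prod InputTy ChoicesTy) (Mat Scal))
         (c d : nat),
  forall (n l p : nat) (A : 'M[R]_n) (lam : 'I_p -> R[i])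
         (X : forall i : 'I_p, 'M[R[i]]_(n, geom_mult A (lam i)))
         (Bbar : 'M[bool]_(n, l)),
    (0 < n)%N ->
    left_eigenbases X ->
    independent_matching X Bbar ->
    [/\ (* every execution returns a matrix with the required properties *)
        forall (S : choices l A lam) (sel : 'I_p -> 'M[R]_(n, l) -> nat),
          step1_valid X Bbar S -> argmax_rule X S sel ->
          exists B : 'M[R]_(n, l),
            [/\ steps23 X S sel = Some B, in_pattern Bbar B & controllable A B],
        (* Step 1 followed by Steps 2 and 3 finds such a matrix in polynomial time *)
        exists (S : choices l A lam) (B : 'M[R]_(n, l)),
          [/\ step1_valid X Bbar S
                /\ result prog1 (enc_input X Bbar) = enc_choices S,
              result (full_prog prog1 prog23) (enc_input X Bbar) = enc_output B,
              in_pattern Bbar B,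
              controllable A B
            & (cost (full_prog prog1 prog23) (enc_input X Bbar)
                 <= c * (n + l) ^ d)%N]
      & (* [prog23] performs Steps 2 and 3, from any outcome of Step 1 *)
        forall S : choices l A lam, step1_valid X Bbar S ->
          let input23 : den R[i] (Prod InputTy ChoicesTy) :=
            (enc_input X Bbar, enc_choices S) in
          exists (sel : 'I_p -> 'M[R]_(n, l) -> nat) (B : 'M[R]_(n, l)),
            [/\ argmax_rule X S sel,
                steps23 X S sel = Some B,
                result prog23 input23 = enc_output B
              & (cost prog23 input23 <= c * (n + l) ^ d)%N]].
Proof.
have [[f Pf Hf] _] : tame R[i] (full_prog step1_prog steps23_prog).
  apply: tame_comp; first exact: good_tame (good_steps23_prog _).
  by apply: tame_pair (tame_step1_prog _); apply: good_tame (good_id _ _).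
have [[g Pg Hg] _] := good_steps23_prog R[i].
have [c [d Hcd]] := poly_bound_add Pf Pg.
exists step1_prog, steps23_prog, (c * 2 ^ d)%N, d => n l p A lam X Bbar n_gt0 eigX matchB.
have cost_le M : (0 < M)%N -> (f M + g M <= c * 2 ^ d * M ^ d)%N.
  (* [M.+1 <= 2 * M] *)
  move=> M_gt0; apply: leq_trans (Hcd M) _; rewrite -mulnA -expnMn leq_mul2l.
  apply/orP; right; case: (d) => // e; rewrite leq_exp2r // mul2n -addnn -addn1.
  by rewrite leq_add2l.
have nl_gt0 : (0 < n + l)%N by rewrite addn_gt0 n_gt0.
have bndi := bnd_enc_input Bbar eigX.
split.
- move=> S sel validS argmax; exists (foldl (visit X S sel) 0 (enum 'I_p)); split.
  + exact: (steps23_visit eigX validS argmax n_gt0).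
  + exact: (visit_pattern validS).
  + exact: (visit_controllable eigX validS argmax).
- have [S [validS ES]] := result_step1_prog n_gt0 matchB.
  have argmax := last_argmaxP X S.
  exists S, (foldl (visit X S (last_argmax X S)) 0 (enum 'I_p)); split.
  + by [].
  + rewrite /full_prog result_comp result_pair result_id ES.
    exact: result_steps23_prog.
  + exact: (visit_pattern validS).
  + exact: (visit_controllable eigX validS argmax).
  + apply: leq_trans (Hf _ _ bndi) _; apply: leq_trans (cost_le _ nl_gt0).
    exact: leq_addr.
move=> S validS input23; have argmax := last_argmaxP X S.
exists (last_argmax X S), (foldl (visit X S (last_argmax X S)) 0 (enum 'I_p)).
split=> //.
- exact: (steps23_visit eigX validS argmax n_gt0).
- exact: result_steps23_prog.
have bnd23 : bnd (n + l) input23.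
  by apply/andP; split; [exact: bndi | exact: (bnd_enc_choices eigX)].
apply: leq_trans (Hg _ _ bnd23) _; apply: leq_trans (cost_le _ nl_gt0).
exact: leq_addl.
Qed.
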